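(* For every $n\in\mathbb Z_{>0}$, the normally ordered $n$-wedges $G(c_1)\wedge G(c_2)\wedge\cdots\wedge G(c_n)$, where $(c_1,\dots,c_n)\in B_{\mathrm{aff}}^n$ satisfies $H(c_r\otimes c_{r+1})>0$ for all $1\le r\le n-1$, form a basis of the $\mathbb Q(q)$-vector space $\bigwedge^nV_{\mathrm{aff}}$.
   Context: Let $\mathfrak g=\widehat{\mathfrak{sl}}_2$, $I=\{0,1\}$, weight lattice $P=\mathbb Z\Lambda_0\oplus\mathbb Z\Lambda_1\oplus\mathbb Z\delta$, coroots $h_0,h_1$ with $\langle h_i,\Lambda_j\rangle=\delta_{ij}$, $\langle h_i,\delta\rangle=0$, central element $c=h_0+h_1$. $U_q(\mathfrak g)$ is the quantum affine algebra over $\mathbb Q(q)$ with generators $e_i,f_i$ ($i\in I$), $q^h$ ($h\in P^*$), $t_i=q^{h_i}$, and coproduct $\Delta(q^h)=q^h\otimes q^h$, $\Delta(e_i)=e_i\otimes1+t_i^{-1}\otimes e_i$, $\Delta(f_i)=f_i\otimes t_i+1\otimes f_i$. $[n]=(q^n-q^{-n})/(q-q^{-1})$. Let $J=\{0,1,2\}$. $V_{\mathrm{aff}}$ is the $\mathbb Q(q)$-space with basis $z^av_j$ ($a\in\mathbb Z$, $j\in J$), a $U_q(\mathfrak g)$-module via: $\mathrm{wt}(z^av_j)=2(1-j)(\Lambda_1-\Lambda_0)+a\delta$, $q^hz^av_j=q^{\langle h,\mathrm{wt}(z^av_j)\rangle}z^av_j$, $e_1z^av_j=[3-j]z^av_{j-1}$,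 $f_1z^av_j=[j+1]z^av_{j+1}$, $e_0z^av_j=[j+1]z^{a+1}v_{j+1}$, $f_0z^av_j=[3-j]z^{a-1}v_{j-1}$ (with $v_{-1}=v_3=0$). The operator $z^b$ sends $z^av_j\mapsto z^{a+b}v_j$. The crystal of $V_{\mathrm{aff}}$ is $B_{\mathrm{aff}}=\{z^ab_j\}$ with lower global base $G(z^ab_j)=z^av_j$; the energy function is $H(z^ab_i\otimes z^{a'}b_j)=\min\{i,2-j\}-a+a'$. $N\subset V_{\mathrm{aff}}\otimes V_{\mathrm{aff}}$ is the smallest subspace containing $v_0\otimes v_0$ that is stable under the action of $U_q(\mathfrak g)$ (via $\Delta$) and under the operators $z\otimes z$, $z^{-1}\otimes z^{-1}$, $z\otimes1+1\otimes z$. For $n\ge2$, $N_n=\sum_{r=0}^{n-2}V_{\mathrm{aff}}^{\otimes r}\otimes N\otimes V_{\mathrm{aff}}^{\otimes(n-r-2)}$ and $\bigwedge^nV_{\mathrm{aff}}:=V_{\mathrm{aff}}^{\otimes n}/N_n$ (a $U_q(\mathfrak g)$-module); $\bigwedge^1V_{\mathrm{aff}}=V_{\mathrm{aff}}$; $u_1\wedge\cdots\wedge u_n$ is the image of $u_1\otimes\cdots\otimes u_n$. *)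

(* Defs.v *)
(* Quantum affine sl_2 level-zero module V_aff (spin 1,
   basis z^a v_j, j in {0,1,2}), its tensor powers, the subspace N and the
   q-wedge space  /\^n V_aff = V_aff^{(x)n} / N_n. *)
From HB Require Import structures.
From mathcomp Require Import all_boot all_order all_algebra.
From mathcomp Require Import finmap.
From mathcomp Require Import fraction.
From mathcomp.multinomials Require Import monalg.
Set Implicit Arguments. Unset Strict Implicit. Unset Printing Implicit Defensive.
Import Order.TTheory GRing.Theory Num.Theory.
Local Open Scope ring_scope.

Definition Qq := {fraction {poly rat}}.
Definition q : Qq := @FracField.tofrac {poly rat} (polyX rat).
Definition qint (n : int) : Qq := (q ^ n - q ^ (- n)) / (q - q^-1).

(* (a, j) stands for z^a b_j  (resp. z^a v_j), j in J = {0,1,2}. *)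
Definition Idx := (int * 'I_3)%type.

(* V_aff, and the tensor algebra: an element of V_aff^{(x)n} is a finitely
   supported Q(q)-combination of the basis tensors
   z^{a_1}v_{j_1} (x) ... (x) z^{a_n}v_{j_n}, labelled by [:: c_1; ...; c_n]. *)
Definition V1 := {malg Qq[Idx]}.
Definition VT := {malg Qq[seq Idx]}.

Definition in_tensor_power (n : nat) (v : VT) : Prop :=
  forall k, k \in msupp v -> size k = n.

Definition vb (a : int) (j : int) : V1 :=
  if (0 <= j) && (j <= 2) then << (a, inord `|j|%N) >> else 0.

(* weights: triples of coordinates on (Lambda_0, Lambda_1, delta) *)
Definition wt (c : Idx) : int * int * int :=
  let: (a, j) := c in (- (2 * (1 - (j : nat)%:Z)), 2 * (1 - (j : nat)%:Z), a).
(* elements h of P^* = Hom(P, Z), given by (<h,Lambda_0>, <h,Lambda_1>, <h,delta>) *)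
Definition pairing (h lam : int * int * int) : int :=
  h.1.1 * lam.1.1 + h.1.2 * lam.1.2 + h.2 * lam.2.
Definition hcor (i : 'I_2) : int * int * int :=
  if val i == 0%N then (1, 0, 0) else (0, 1, 0).
Definition hneg (h : int * int * int) : int * int * int := (- h.1.1, - h.1.2, - h.2).

Definition act_qh (h : int * int * int) (c : Idx) : V1 :=
  q ^ (pairing h (wt c)) *: << c >>.
Definition act_e (i : 'I_2) (c : Idx) : V1 :=
  let: (a, j) := c in let j := (j : nat)%:Z in
  if val i == 0%N then qint (j + 1) *: vb (a + 1) (j + 1)
  else qint (3 - j) *: vb a (j - 1).
Definition act_f (i : 'I_2) (c : Idx) : V1 :=
  let: (a, j) := c in let j := (j : nat)%:Z in
  if val i == 0%N then qint (3 - j) *: vb (a - 1) (j - 1)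
  else qint (j + 1) *: vb a (j + 1).

Definition tens (x y : V1) : VT :=
  \sum_(k <- msupp x) \sum_(l <- msupp y) (x@_k * y@_l) *: << [:: k; l] >>.

Definition ext2 (F : Idx -> Idx -> VT) (x : VT) : VT :=
  \sum_(k <- msupp x) x@_k *: (match k with [:: c; d] => F c d | _ => 0 end).

Definition Delta_e (i : 'I_2) : VT -> VT := ext2 (fun c d =>
  tens (act_e i c) << d >> + tens (act_qh (hneg (hcor i)) c) (act_e i d)).
Definition Delta_f (i : 'I_2) : VT -> VT := ext2 (fun c d =>
  tens (act_f i c) (act_qh (hcor i) d) + tens << c >> (act_f i d)).
Definition Delta_qh (h : int * int * int) : VT -> VT := ext2 (fun c d =>
  tens (act_qh h c) (act_qh h d)).

Definition zsh (b : int) (c : Idx) : Idx := (c.1 + b, c.2).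
Definition z_z : VT -> VT := ext2 (fun c d => << [:: zsh 1 c; zsh 1 d] >>).
Definition zinv_zinv : VT -> VT := ext2 (fun c d => << [:: zsh (-1) c; zsh (-1) d] >>).
Definition z1_1z : VT -> VT :=
  ext2 (fun c d => << [:: zsh 1 c; d] >> + << [:: c; zsh 1 d] >>).

Definition v0 : Idx := (0%Z, ord0).

(* N: the smallest subspace of V_aff (x) V_aff containing v_0 (x) v_0 and
   stable under U_q(g) (i.e. under the generators e_i, f_i, q^h acting via
   Delta) and under z(x)z, z^-1(x)z^-1, z(x)1+1(x)z. *)
Inductive Nsub : VT -> Prop :=
| N_gen : Nsub << [:: v0; v0] >>
| N_zero : Nsub 0
| N_lin (a : Qq) x y : Nsub x -> Nsub y -> Nsub (a *: x + y)
| N_e i x : Nsub x -> Nsub (Delta_e i x)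
| N_f i x : Nsub x -> Nsub (Delta_f i x)
| N_qh h x : Nsub x -> Nsub (Delta_qh h x)
| N_zz x : Nsub x -> Nsub (z_z x)
| N_zinv x : Nsub x -> Nsub (zinv_zinv x)
| N_z1 x : Nsub x -> Nsub (z1_1z x).

Definition sandwich (p : seq Idx) (x : VT) (s : seq Idx) : VT :=
  \sum_(k <- msupp x) x@_k *: << p ++ k ++ s >>.

(* N_n = sum_{r=0}^{n-2} V^{(x)r} (x) N (x) V^{(x)(n-r-2)} (r = size p);
   for n = 1 this is the zero subspace. *)
Inductive Nn (n : nat) : VT -> Prop :=
| Nn_zero : Nn n 0
| Nn_lin (a : Qq) x y : Nn n x -> Nn n y -> Nn n (a *: x + y)
| Nn_gen (p s : seq Idx) x :
    (size p + 2 + size s)%N = n -> Nsub x -> Nn n (sandwich p x s).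

Definition energy (c d : Idx) : int :=
  (minn (c.2 : nat) (2 - (d.2 : nat)))%:Z - c.1 + d.1.

Definition normally_ordered (n : nat) (c : seq Idx) : Prop :=
  size c = n /\
  forall r : nat, (r.+1 < n)%N -> 0 < energy (nth v0 c r) (nth v0 c r.+1).

(* The images in Amb/Sub of the basis tensors <<c>> (c with B c) form a basis
   of the quotient space Amb / Sub: they span, and they are linearly
   independent modulo Sub.  A linear combination of the <<c>>, c in B, is
   exactly an element w of VT supported in B. *)
Definition quotient_basis (Amb Sub : VT -> Prop) (B : seq Idx -> Prop) : Prop :=
  (forall v, Amb v ->
     exists w : VT, (forall c, c \in msupp w -> B c) /\ Sub (v - w)) /\
  (forall w : VT, (forall c, c \in msupp w -> B c) -> Sub w -> w = 0).

(* Main.v *)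
Require Import Defs.
From HB Require Import structures.
From mathcomp Require Import all_boot all_order all_algebra.
From mathcomp Require Import finmap fraction.
From mathcomp.multinomials Require Import monalg.
From mathcomp Require Import generic_quotient.
From mathcomp Require Import ring zify.
From Stdlib Require BinNat.

(* Independence.  Let T be the R-matrix of V_aff (x) V_aff multiplied by
   D = (1 - q^2 z1/z2) (1 - q^4 z1/z2), which makes its entries Laurent
   polynomials.  T commutes with U_q(g) and with the symmetric Laurent
   polynomials in z1, z2, and T = D on v_0 (x) v_0, so T = D on N.  By the
   Yang-Baxter equation the q-antisymmetrizer built from the T_i then kills N_n.
   Modulo q the R-matrix only exchanges shifted exponents of z, and a tensor is
   normally ordered iff its shifted exponents strictly increase; so the matrix
   of the antisymmetrizer on normally ordered tensors is the identity modulo q.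
   A nonzero combination of normally ordered tensors, scaled so as to be
   nonzero modulo q, is therefore not killed by it.

   Spanning.  N contains, for each pair (i, j), a vector with leading term
   z^h v_i (x) v_j of energy 0, and is stable under z1^m + z2^m; this rewrites
   every pair of nonpositive energy.  Each rewriting moves the levels
   2 a - j of the two factors z^a v_j inwards (or exchanges them), so
   \sum_r r * level(c_r) increases, and it stays bounded. *)

Set Implicit Arguments.
Unset Strict Implicit.
Unset Printing Implicit Defensive.
Import Order.TTheory GRing.Theory Num.Theory.
Local Open Scope ring_scope.
(* Otherwise failing unifications unfold finitely supported functions and
   practically diverge. *)
Local Opaque mkmalgU.

(** * Linear extension from basis tensors *)

(** Independence needs a linear map that kills N_n and can still be read modulo q. This is why D is
    multiplied into T instead of dividing by it: every power of q in T is then nonnegative, and D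
    itself becomes 1 modulo q. The antisymmetrizer is summed along the cosets of S_(n-1) in S_n. If
    T_i and D agree on x, the coset sum turns x into vectors on which they agree at a position away
    from the front factor; the antisymmetrizer of the remaining factors kills these by induction.
    The operator identities behind this involve infinitely many z-exponents. The operators act on
    exponents only by translations and exchanges, so each identity is computed once for every tuple
    of indices, with indeterminate exponents. *)

HB.lock Definition lin (R : comNzRingType) (K : choiceType) (V : lmodType R)
  (F : K -> V) (x : {malg R[K]}) : V := \sum_(k <- msupp x) x@_k *: F k.
Canonical lin_unlockable := Unlockable lin.unlock.

Section LinearExtension.
Variables (R : comNzRingType) (K : choiceType).
Implicit Types (V : lmodType R) (x y : {malg R[K]}).

Lemma linE V (F : K -> V) x : lin F x = \sum_(k <- msupp x) x@_k *: F k.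
Proof. by rewrite unlock. Qed.

Lemma linEw V (F : K -> V) (d : {fset K}) x : (msupp x `<=` d)%fset ->
  lin F x = \sum_(k <- d) x@_k *: F k.
Proof.
move=> sub; rewrite linE (big_fset_incl _ sub) // => k _ /mcoeff_outdom ->.
by rewrite scale0r.
Qed.

Lemma lin_is_linear V (F : K -> V) : linear (lin F).
Proof.
move=> a x y; pose d := (msupp (a *: x + y) `|` msupp x `|` msupp y)%fset.
have [s1 s2 s3] : [/\ (msupp (a *: x + y) `<=` d)%fset, (msupp x `<=` d)%fset
    & (msupp y `<=` d)%fset].
  by split; apply/fsubsetP => k kd; rewrite !in_fsetU kd ?orbT.
rewrite !(@linEw _ _ d) //.
rewrite scaler_sumr -big_split /=; apply: eq_bigr => k _.
by rewrite mcoeffD mcoeffZ scalerDl scalerA.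
Qed.

HB.instance Definition _ V (F : K -> V) :=
  GRing.isLinear.Build R {malg R[K]} V *:%R (lin F) (@lin_is_linear V F).

Lemma lin0 V (F : K -> V) : lin F 0 = 0.
Proof. exact: linear0. Qed.

Lemma linD V (F : K -> V) x y : lin F (x + y) = lin F x + lin F y.
Proof. exact: linearD. Qed.

Lemma linU V (F : K -> V) k : lin F << k >> = F k.
Proof. by rewrite linE msuppU oner_eq0 big_seq_fset1 mcoeffUU scale1r. Qed.

Lemma eq_in_lin V (F G : K -> V) x :
  (forall k, k \in msupp x -> F k = G k) -> lin F x = lin G x.
Proof. by move=> eqFG; rewrite !linE; apply: eq_big_seq => k /eqFG ->. Qed.

Lemma eq_lin V (F G : K -> V) : F =1 G -> lin F =1 lin G.
Proof. by move=> eqFG x; apply: eq_in_lin => k _. Qed.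

Lemma linear_lin (V W : lmodType R) (f : {linear V -> W}) (F : K -> V) x :
  f (lin F x) = lin (fun k => f (F k)) x.
Proof. by rewrite !linE linear_sum; apply: eq_bigr => k _; rewrite linearZ. Qed.

Lemma lin_id x : lin (fun k => << k >>) x = x.
Proof.
rewrite linE [RHS]monalgE; apply: eq_bigr => k _.
by apply/malgP => k'; rewrite mcoeffZ !mcoeffU mulr_natr.
Qed.

Lemma mem_msuppD x y k :
  k \in msupp (x + y) -> k \in msupp x \/ k \in msupp y.
Proof. by move/(fsubsetP (msuppD_le x y)); rewrite in_fsetU => /orP. Qed.

Lemma mem_msuppZ a x k : k \in msupp (a *: x) -> k \in msupp x.
Proof. exact: (fsubsetP (msuppZ_le a x)). Qed.

Lemma mem_msupp_sum (I : eqType) (r : seq I) (f : I -> {malg R[K]}) k :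
  k \in msupp (\sum_(i <- r) f i) -> exists2 i, i \in r & k \in msupp (f i).
Proof.
elim: r => [|i r IH]; first by rewrite big_nil msupp0 in_fset0.
rewrite big_cons => /mem_msuppD[ki|/IH[j jr kj]].
- by exists i; rewrite // mem_head.
- by exists j; rewrite // inE jr orbT.
Qed.

End LinearExtension.

Lemma mem_msupp_lin (R : comNzRingType) (K K' : choiceType)
    (F : K -> {malg R[K']}) x k' :
  k' \in msupp (lin F x) -> exists2 k, k \in msupp x & k' \in msupp (F k).
Proof. by rewrite linE; case/mem_msupp_sum => k kx /mem_msuppZ; exists k. Qed.

Lemma mcoeff_lin (R : comNzRingType) (K K' : choiceType)
    (F : K -> {malg R[K']}) x k' :
  (lin F x)@_k' = \sum_(k <- msupp x) x@_k * (F k)@_k'.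
Proof.
by rewrite linE raddf_sum; apply: eq_bigr => k _; rewrite /= mcoeffZ.
Qed.

Lemma lin_lin (R : comNzRingType) (K K' : choiceType) (V : lmodType R)
    (F : K' -> V) (G : K -> {malg R[K']}) x :
  lin F (lin G x) = lin (fun k => lin F (G k)) x.
Proof. exact: linear_lin. Qed.

(** * Words as basis tensors, and operators away from the first factor *)

Section TensorPowers.
Variables (R : comNzRingType) (A : choiceType).
Local Notation TA := {malg R[seq A]}.
Local Notation op := (seq A -> TA).
Implicit Types (F G : op) (c : A) (k s : seq A) (x y : TA).

Definition consl c : TA -> TA := lin (fun k => << c :: k >>).
HB.instance Definition _ c := GRing.Linear.on (consl c).

Lemma consl0 c : consl c 0 = 0.
Proof. exact: lin0. Qed.

Lemma conslD c x y : consl c (x + y) = consl c x + consl c y.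
Proof. exact: linD. Qed.

(** The operator id (x) F. With the value 0 on the empty word, an operator moved to position i kills
    the words shorter than i. *)
Definition shift F : op := fun k => if k is c :: s then consl c (F s) else 0.

Definition catl s : TA -> TA := lin (fun k => << k ++ s >>).
HB.instance Definition _ s := GRing.Linear.on (catl s).

Lemma lin_shift_consl F c x : lin (shift F) (consl c x) = consl c (lin F x).
Proof.
rewrite {1}/consl lin_lin [RHS]linear_lin; apply: eq_lin => k /=.
by rewrite linU.
Qed.

Lemma shift_comp F G k :
  shift (fun k' => lin F (G k')) k = lin (shift F) (shift G k).
Proof. by case: k => [|c s] /=; rewrite ?linear0 // lin_shift_consl. Qed.

Lemma eq_shift F G : F =1 G -> shift F =1 shift G.
Proof. by move=> eqFG [|c s] //=; rewrite eqFG. Qed.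

Lemma lin_shift_comp F G x :
  lin (shift F) (lin (shift G) x) = lin (shift (fun k => lin F (G k))) x.
Proof.
by rewrite lin_lin; apply: eq_lin => k; exact/esym/shift_comp.
Qed.

Definition slice c : TA -> TA :=
  lin (fun k => if k is c' :: s then if c' == c then << s >> else 0 else 0).
HB.instance Definition _ c := GRing.Linear.on (slice c).

Lemma mcoeff_slice c x k : (slice c x)@_k = x@_(c :: k).
Proof.
rewrite -[x in RHS]lin_id /slice !mcoeff_lin.
apply: eq_bigr => k' _; rewrite mcoeffU; congr (_ * _).
case: k' => [|c' s]; rewrite ?mcoeff0 //= eqseq_cons.
by case: eqP => _; rewrite ?mcoeff0 // mcoeffU.
Qed.

Lemma slice_consl c x : slice c (consl c x) = x.
Proof.
rewrite /slice /consl lin_lin -[RHS]lin_id; apply: eq_lin => k.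
by rewrite linU eqxx.
Qed.

Lemma sliceU c k : slice c << c :: k >> = << k >>.
Proof. by rewrite -[RHS](slice_consl c) /consl linU. Qed.

Lemma slice_consl_neq c c' x : c' != c -> slice c (consl c' x) = 0.
Proof.
move=> neq; rewrite /slice /consl lin_lin (eq_lin (G := fun=> 0)) => [|k].
  by rewrite linE big1 // => k _; rewrite scaler0.
by rewrite linU (negPf neq).
Qed.

Lemma slice_shift c F x : slice c (lin (shift F) x) = lin F (slice c x).
Proof.
rewrite {1}/slice [in LHS]lin_lin -/(slice c) [in RHS]/slice [in RHS]lin_lin.
apply: eq_lin => -[|c' s] /=; rewrite ?linear0 // -/(slice c _).
have [->|neq] := eqVneq c' c; first by rewrite slice_consl linU.
by rewrite slice_consl_neq ?linear0.
Qed.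

Lemma mcoeff_consl_nil c x : (consl c x)@_[::] = 0.
Proof. by rewrite mcoeff_lin big1 // => k _; rewrite mcoeffU mulr0. Qed.

Lemma mcoeff_shift_nil F x : (lin (shift F) x)@_[::] = 0.
Proof.
rewrite mcoeff_lin big1 // => -[|c k] _; first by rewrite mcoeff0 mulr0.
by rewrite mcoeff_consl_nil mulr0.
Qed.

(** Decomposing x along its first factor reduces statements about id (x) F to F on the slices; only
    first letters from the support contribute. *)
Lemma lin_shift_slice F x :
  lin (shift F) x = \sum_(c <- undup (pmap ohead (msupp x)))
    consl c (lin F (slice c x)).
Proof.
apply/malgP => -[|c k]; rewrite [RHS]raddf_sum /=.
  by rewrite mcoeff_shift_nil big1 // => c _; rewrite mcoeff_consl_nil.
rewrite -!mcoeff_slice slice_shift.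
(* Only the summand of first letter c matters; if no word of the support starts with c, the slice is
   0. *)
have -> : (lin F (slice c x))@_k =
    \sum_(c' <- undup (pmap ohead (msupp x)))
      if c' == c then (lin F (slice c x))@_k else 0.
  case cx: (c \in undup (pmap ohead (msupp x))).
    rewrite (bigD1_seq c) ?undup_uniq //= eqxx big1 ?addr0 // => c'.
    by move/negPf->.
  suff -> : slice c x = 0 by rewrite linear0 mcoeff0 big1 // => c' _; case: ifP.
  apply/malgP => s; rewrite mcoeff_slice mcoeff0 mcoeff_outdom //.
  apply: contraFN cx => sx; rewrite mem_undup mem_pmap.
  by apply/mapP; exists (c :: s).
apply: eq_bigr => c' _ /=; rewrite -mcoeff_slice.
case: eqP => [->|/eqP neq]; first by rewrite slice_consl.
by rewrite slice_consl_neq // mcoeff0.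
Qed.

End TensorPowers.

(** * Formal tensors and the Yang-Baxter equation *)

Definition o0 : 'I_3 := @Ordinal 3 0 isT.
Definition o1 : 'I_3 := @Ordinal 3 1 isT.
Definition o2 : 'I_3 := @Ordinal 3 2 isT.

(* The R-matrix times (1 - q^2 z1/z2) (1 - q^4 z1/z2): an entry
   (n, e, m, i', j') of [rtab i j] stands for the term
   n q^e (z1/z2)^m v_i' (x) v_j' of the image of v_i (x) v_j. *)
Definition rtab (i j : 'I_3) : seq (int * int * int * 'I_3 * 'I_3) :=
  match val i, val j return seq (int * int * int * 'I_3 * 'I_3) with
  | 0%N, 0%N => [:: (1, 0, 0, o0, o0); (-1, 2, 1, o0, o0); (-1, 4, 1, o0, o0);
      (1, 6, 2, o0, o0)]
  | 0%N, 1%N => [:: (1, 0, 0, o0, o1); (-1, 2, 1, o0, o1); (-1, 4, 0, o0, o1);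
      (1, 6, 1, o0, o1); (1, 2, 0, o1, o0); (-1, 2, 1, o1, o0);
      (-1, 4, 1, o1, o0); (1, 4, 2, o1, o0)]
  | 0%N, 2%N => [:: (1, 0, 0, o0, o2); (-1, 2, 0, o0, o2); (-1, 4, 0, o0, o2);
      (1, 6, 0, o0, o2); (1, 1, 0, o1, o1); (-1, 1, 1, o1, o1);
      (-1, 3, 0, o1, o1); (1, 3, 1, o1, o1); (-1, 2, 1, o2, o0);
      (1, 2, 2, o2, o0); (1, 4, 0, o2, o0); (-1, 4, 1, o2, o0)]
  | 1%N, 0%N => [:: (1, 2, 0, o0, o1); (-1, 2, 1, o0, o1); (-1, 4, 1, o0, o1);
      (1, 4, 2, o0, o1); (1, 0, 1, o1, o0); (-1, 2, 2, o1, o0);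
      (-1, 4, 1, o1, o0); (1, 6, 2, o1, o0)]
  | 1%N, 1%N => [:: (1, 1, 0, o0, o2); (-1, 1, 1, o0, o2); (1, 3, 0, o0, o2);
      (-1, 3, 1, o0, o2); (-1, 5, 0, o0, o2); (1, 5, 1, o0, o2);
      (-1, 7, 0, o0, o2); (1, 7, 1, o0, o2); (1, 0, 1, o1, o1);
      (1, 2, 0, o1, o1); (-2, 2, 1, o1, o1); (-2, 4, 1, o1, o1);
      (1, 4, 2, o1, o1); (1, 6, 1, o1, o1); (1, 1, 1, o2, o0);
      (-1, 1, 2, o2, o0); (1, 3, 1, o2, o0); (-1, 3, 2, o2, o0);
      (-1, 5, 1, o2, o0); (1, 5, 2, o2, o0); (-1, 7, 1, o2, o0);
      (1, 7, 2, o2, o0)]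
  | 1%N, 2%N => [:: (1, 0, 0, o1, o2); (-1, 2, 1, o1, o2); (-1, 4, 0, o1, o2);
      (1, 6, 1, o1, o2); (1, 2, 0, o2, o1); (-1, 2, 1, o2, o1);
      (-1, 4, 1, o2, o1); (1, 4, 2, o2, o1)]
  | 2%N, 0%N => [:: (-1, 2, 1, o0, o2); (1, 2, 2, o0, o2); (1, 4, 0, o0, o2);
      (-1, 4, 1, o0, o2); (1, 1, 1, o1, o1); (-1, 1, 2, o1, o1);
      (-1, 3, 1, o1, o1); (1, 3, 2, o1, o1); (1, 0, 2, o2, o0);
      (-1, 2, 2, o2, o0); (-1, 4, 2, o2, o0); (1, 6, 2, o2, o0)]
  | 2%N, 1%N => [:: (1, 2, 0, o1, o2); (-1, 2, 1, o1, o2); (-1, 4, 1, o1, o2);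
      (1, 4, 2, o1, o2); (1, 0, 1, o2, o1); (-1, 2, 2, o2, o1);
      (-1, 4, 1, o2, o1); (1, 6, 2, o2, o1)]
  | 2%N, 2%N => [:: (1, 0, 0, o2, o2); (-1, 2, 1, o2, o2); (-1, 4, 1, o2, o2);
      (1, 6, 2, o2, o2)]
  | _, _ => [::]
  end%Z.

(* Formal tensors: an entry (r, a, j) of a key stands for z^(x_r + a) v_j with
   indeterminate exponents x_r, and a term (n, e, k) for n q^e times the basis
   tensor k. *)
Definition fkey := seq (nat * int * 'I_3).
Definition fsum := seq (int * int * fkey).

Local Notation N := BinNums.N.
Local Notation n2N := BinNat.N.of_nat.
Local Notation "x +' y" := (BinNat.N.add x y) (at level 50).
Local Notation "x *' y" := (BinNat.N.mul x y) (at level 40).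

(* These codes only make [fnorm] fast: its soundness uses of the sorting step
   nothing but that it is a permutation. *)
Definition zcode (z : int) : N :=
  n2N (match z with Posz n => n + 16 | Negz n => 15 - n end).
Fixpoint kcode (a : N) (k : fkey) : N :=
  if k is x :: k' then
    kcode (n2N 4 *' (n2N 64 *' a +' zcode x.1.2) +' n2N (val x.2)) k' else a.
Definition tcode (t : int * int * fkey) : N :=
  n2N 64 *' kcode (n2N 0) t.2 +' zcode t.1.2.

Fixpoint fmerge (t : int * int * fkey) (l : fsum) : fsum :=
  if l is t' :: l' then
    if (t.1.2 == t'.1.2) && (t.2 == t'.2) then
      fmerge (t.1.1 + t'.1.1, t.1.2, t.2) l'
    else if t.1.1 == 0 then fmerge t' l' else t :: fmerge t' l'
  else if t.1.1 == 0 then [::] else [:: t].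
Definition fnorm (l : fsum) : fsum :=
  if sort (fun t t' => BinNat.N.leb t.1 t'.1) [seq (tcode t, t) | t <- l]
  is t :: l' then fmerge t.2 [seq u.2 | u <- l'] else [::].

Definition fbind (F : fkey -> fsum) (l : fsum) : fsum :=
  fnorm (flatten [seq [seq (t.1.1 * u.1.1, t.1.2 + u.1.2, u.2) | u <- F t.2]
                 | t <- l]).

Definition fopp (l : fsum) : fsum := [seq (- t.1.1, t.1.2, t.2) | t <- l].
Definition fsize (n : nat) (l : fsum) : bool := all (fun t => size t.2 == n) l.
Definition feq (l l' : fsum) : bool := nilp (fnorm (l ++ fopp l')).

Definition frmat : fkey -> fsum := fun k =>
  if k is x :: y :: k' then
    [seq let: (c, e, s, i, j) := t in
         (c, e, (y.1.1, y.1.2 + s, i) :: (x.1.1, x.1.2 - s, j) :: k')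
    | t <- rtab x.2 y.2]
  else [::].

Definition fshift (F : fkey -> fsum) : fkey -> fsum := fun k =>
  if k is x :: k' then [seq (t.1, x :: t.2) | t <- F k'] else [::].

Definition o3s := [:: o0; o1; o2].

(** These 27 cases give the Yang-Baxter equation for all exponents, because the x_r are
    indeterminate. The size conditions ensure that [frmat] and its shift only meet words of length
    three, on which they agree with the actual operators. *)
Lemma braid_check : all (fun i => all (fun j => all (fun k =>
  let l : fsum := [:: (1, 0, [:: (0%N, 0, i); (1%N, 0, j); (2%N, 0, k)])] in
  let T0 := fbind frmat in let T1 := fbind (fshift frmat) in
  let a1 := T0 l in let a2 := T1 a1 in let a3 := T0 a2 in
  let b1 := T1 l in let b2 := T0 b1 in let b3 := T1 b2 in
  [&& fsize 3 a1, fsize 3 a2, fsize 3 b1, fsize 3 b2 & feq a3 b3])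
  o3s) o3s) o3s.
Proof. by vm_compute. Qed.

Section FormalSemantics.
Variables (R : comNzRingType) (q : int -> R) (rho : nat -> int) (s : seq Idx).
Hypothesis qD : forall a b, q (a + b) = q a * q b.
Local Notation TK := {malg R[seq Idx]}.

Definition evk (k : fkey) : seq Idx :=
  [seq (rho x.1.1 + x.1.2, x.2) | x <- k] ++ s.
Definition evt (t : int * int * fkey) : TK :=
  (t.1.1%:~R * q t.1.2) *: << evk t.2 >>.
Definition ev (l : fsum) : TK := \sum_(t <- l) evt t.

Lemma evt_add t t' : t.1.2 = t'.1.2 -> t.2 = t'.2 ->
  evt (t.1.1 + t'.1.1, t.1.2, t.2) = evt t + evt t'.
Proof.
by move=> e1 e2; rewrite /evt /= -e1 -e2 -scalerDl -mulrDl intrD.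
Qed.

Lemma evt0 t : t.1.1 = 0 -> evt t = 0.
Proof. by move=> t0; rewrite /evt t0 mul0r scale0r. Qed.

Lemma ev_cat l l' : ev (l ++ l') = ev l + ev l'.
Proof. exact: big_cat. Qed.

Lemma ev_fopp l : ev (fopp l) = - ev l.
Proof.
rewrite /ev big_map -sumrN; apply: eq_bigr => t _.
by rewrite /evt /= mulrNz mulNr scaleNr.
Qed.

Lemma ev_fmerge t l : ev (fmerge t l) = evt t + ev l.
Proof.
elim: l t => [|t' l IH] t /=.
  case: eqP => [/evt0->|_]; first by rewrite add0r.
  by rewrite /ev big_seq1 big_nil addr0.
rewrite [ev (t' :: l)]big_cons -/(ev l).
case: ifP => [/andP[/eqP e1 /eqP e2]|_].
  by rewrite IH evt_add // addrA.
case: eqP => [/evt0->|_]; first by rewrite IH add0r.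
by rewrite [LHS]big_cons -/(ev _) IH.
Qed.

Lemma ev_fnorm l : ev (fnorm l) = ev l.
Proof.
set r := (fun t t' : BinNums.N * (int * int * fkey) => BinNat.N.leb t.1 t'.1).
have -> : ev l = ev [seq t.2 | t <- sort r [seq (tcode t, t) | t <- l]].
  rewrite -[X in ev X](mapK (g := snd) (f := fun t => (tcode t, t))) //.
  rewrite /ev; apply: perm_big; apply: perm_map.
  by rewrite perm_sym perm_sort.
rewrite /fnorm -/r; case: sort => [|t l'] //=.
by rewrite ev_fmerge [RHS]big_cons.
Qed.

Lemma feq_ev l l' : feq l l' -> ev l = ev l'.
Proof.
rewrite /feq /nilp size_eq0 => /eqP n0; apply/eqP; rewrite -subr_eq0.
by rewrite -ev_fopp -ev_cat -ev_fnorm n0 /ev big_nil.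
Qed.

Lemma ev_fbind (L : seq Idx -> TK) F l :
  (forall t, t \in l -> L (evk t.2) = ev (F t.2)) ->
  lin L (ev l) = ev (fbind F l).
Proof.
move=> LF; rewrite ev_fnorm /ev linear_sum big_flatten big_map.
apply: eq_big_seq => t /LF Lt; rewrite linearZ /= linU Lt /ev big_map.
rewrite scaler_sumr; apply: eq_bigr => u _.
by rewrite /evt /= intrM qD scalerA mulrACA.
Qed.

Lemma ev_fbind_size (n : nat) (L : seq Idx -> TK) F l :
  (forall k, size k = n -> L (evk k) = ev (F k)) -> fsize n l ->
  lin L (ev l) = ev (fbind F l).
Proof.
by move=> LF /allP sz; apply: ev_fbind => t /sz /eqP; apply: LF.
Qed.

(** The powers of q enter through a function on exponents, so that one table serves both over Q(q)
    and at q = 0, where negative powers have no value. *)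
Definition rmat (k : seq Idx) : TK :=
  if k is c :: d :: k' then
    \sum_(t <- rtab c.2 d.2) let: (n, e, m, i, j) := t in
      (n%:~R * q e) *: << (d.1 + m, i) :: (c.1 - m, j) :: k' >>
  else 0.

Lemma rmat_ev n k : size k = n.+2 -> rmat (evk k) = ev (frmat k).
Proof.
case: k => [|x [|y k]] //= _; rewrite /ev big_map.
apply: eq_bigr => -[[[[c e] m] i] j] _.
by rewrite /evt /evk /= !addrA addrAC.
Qed.

End FormalSemantics.

Lemma fshift_ev (R : comNzRingType) (q : int -> R) rho s (n : nat)
    (L : seq Idx -> {malg R[seq Idx]}) F :
  (forall k, size k = n -> L (evk rho s k) = ev q rho s (F k)) ->
  forall k, size k = n.+1 -> shift L (evk rho s k) = ev q rho s (fshift F k).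
Proof.
move=> LF [|x k] //= [/LF Lk]; rewrite -/(evk rho s k) Lk.
rewrite /ev big_map linear_sum; apply: eq_bigr => t _.
by rewrite /evt linearZ /= /consl linU.
Qed.

Lemma ord3P (P : 'I_3 -> Prop) : P o0 -> P o1 -> P o2 -> forall i, P i.
Proof.
move=> P0 P1 P2 [[|[|[|m]]] Hm] //.
- by rewrite (_ : Ordinal _ = o0) //; apply: val_inj.
- by rewrite (_ : Ordinal _ = o1) //; apply: val_inj.
- by rewrite (_ : Ordinal _ = o2) //; apply: val_inj.
Qed.

Lemma mem_o3s i : i \in o3s.
Proof. by move: i; apply: ord3P. Qed.

Lemma rmat_braid (R : comNzRingType) (q : int -> R)
    (qD : forall a b, q (a + b) = q a * q b) (q0 : q 0 = 1) x :
  lin (rmat q) (lin (shift (rmat q)) (lin (rmat q) x)) =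
  lin (shift (rmat q)) (lin (rmat q) (lin (shift (rmat q)) x)).
Proof.
rewrite !lin_lin; apply: eq_lin => k; rewrite -!lin_lin.
case: k => [|c [|d [|e s]]].
- by rewrite /= !lin0.
- by rewrite /= ?consl0 !lin0.
- have -> : shift (rmat q) [:: c; d] = 0 by rewrite /= consl0.
  suff -> : lin (shift (rmat q)) (rmat q [:: c; d]) = 0 by rewrite !lin0.
  rewrite linear_sum big1 // => -[[[[n e] m] i] j] _.
  by rewrite linearZ /= linU /= consl0 scaler0.
have := braid_check; move/allP/(_ c.2 (mem_o3s _))/allP/(_ d.2 (mem_o3s _)).
move/allP/(_ e.2 (mem_o3s _)); set l := [:: _].
(* The indeterminate exponents are specialised to those of the three given factors. *)
pose rho n := nth 0 [:: c.1; d.1; e.1] n.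
have -> : c :: d :: e :: s =
    evk rho s [:: (0%N, 0, c.2); (1%N, 0, d.2); (2%N, 0, e.2)].
  by rewrite /evk /rho /= !addr0 -!surjective_pairing.
rewrite -[rmat q _](linU (rmat q)) -[shift (rmat q) _](linU (shift (rmat q))).
have -> : << evk rho s [:: (0%N, 0, c.2); (1%N, 0, d.2); (2%N, 0, e.2)] >> =
    ev q rho s l.
  by rewrite /ev big_seq1 /evt /= mul1r q0 scale1r.
have R0 l' : fsize 3 l' ->
    lin (rmat q) (ev q rho s l') = ev q rho s (fbind frmat l').
  apply: ev_fbind_size => //; exact: rmat_ev.
have R1 l' : fsize 3 l' ->
    lin (shift (rmat q)) (ev q rho s l') = ev q rho s (fbind (fshift frmat) l').
  apply: ev_fbind_size => //; apply: fshift_ev; exact: rmat_ev.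
move: (fbind frmat) (fbind (fshift frmat)) R0 R1 => T0 T1 R0 R1.
case/and5P=> sa1 sa2 sb1 sb2 eqab.
rewrite (R0 l isT) (R1 _ sa1) (R0 _ sa2) (R1 l isT) (R0 _ sb1) (R1 _ sb2).
exact: feq_ev.
Qed.

Section PointwiseLin.
Variables (R : comNzRingType) (K : choiceType) (V : lmodType R).
Implicit Types (F G : K -> V) (x : {malg R[K]}).

Lemma lin_addf F G x : lin (fun k => F k + G k) x = lin F x + lin G x.
Proof.
by rewrite !linE -big_split; apply: eq_bigr => k _; rewrite /= scalerDr.
Qed.

Lemma lin_scalef a F x : lin (fun k => a *: F k) x = a *: lin F x.
Proof.
rewrite !linE scaler_sumr; apply: eq_bigr => k _.
by rewrite !scalerA mulrC.
Qed.

Lemma lin_oppf F x : lin (fun k => - F k) x = - lin F x.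
Proof. by rewrite !linE -sumrN; apply: eq_bigr => k _; rewrite scalerN. Qed.

Lemma lin_subf F G x : lin (fun k => F k - G k) x = lin F x - lin G x.
Proof. by rewrite lin_addf lin_oppf. Qed.

Lemma lin_zerof x : lin (fun=> 0 : V) x = 0.
Proof. by rewrite linE big1 // => k _; rewrite scaler0. Qed.

Lemma lin_sumf (I : Type) (r : seq I) (F : I -> K -> V) x :
  lin (fun k => \sum_(i <- r) F i k) x = \sum_(i <- r) lin (F i) x.
Proof.
elim: r => [|i r IH].
  by rewrite big_nil -[RHS](lin_zerof x); apply: eq_lin => k; rewrite big_nil.
by rewrite big_cons -IH -lin_addf; apply: eq_lin => k; rewrite big_cons.
Qed.

End PointwiseLin.

(** * Intertwining relations *)

Section ShiftAlgebra.
Variables (R : comNzRingType) (A : choiceType).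
Local Notation TA := {malg R[seq A]}.
Local Notation op := (seq A -> TA).
Implicit Types (F G H : op) (x y : TA).

Lemma lin_shift_subf F G x :
  lin (shift (fun k => F k - G k)) x = lin (shift F) x - lin (shift G) x.
Proof.
rewrite -lin_subf; apply: eq_lin => -[|c s] /=; first by rewrite subr0.
by rewrite linearB.
Qed.

(** G and H may differ because T does not commute with z_j: moving T past it permutes the index
    j. *)
Definition inter F G H := forall x, lin F (lin G x) = lin H (lin F x).

Lemma inter_basis F G H : (forall k, lin F (G k) = lin H (F k)) -> inter F G H.
Proof. by move=> FGH x; rewrite !lin_lin; apply: eq_lin. Qed.

Lemma inter_sym F G : inter F G G -> inter G F F.
Proof. by move=> FG x; rewrite FG. Qed.

Lemma inter_shift F G H : inter F G H -> inter (shift F) (shift G) (shift H).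
Proof.
by move=> FGH x; rewrite !lin_shift_comp; apply/eq_lin/eq_shift => k;
  have:= FGH << k >>; rewrite !linU.
Qed.

Lemma inter_comp F G H G' H' : inter F G H -> inter F G' H' ->
  inter F (fun k => lin G (G' k)) (fun k => lin H (H' k)).
Proof. by move=> FGH FGH' x; rewrite -!lin_lin FGH FGH'. Qed.

Lemma inter_add F G H G' H' : inter F G H -> inter F G' H' ->
  inter F (fun k => G k + G' k) (fun k => H k + H' k).
Proof. by move=> FGH FGH' x; rewrite !lin_addf linearD /= FGH FGH'. Qed.

Lemma inter_sub F G H G' H' : inter F G H -> inter F G' H' ->
  inter F (fun k => G k - G' k) (fun k => H k - H' k).
Proof. by move=> FGH FGH' x; rewrite !lin_subf linearB /= FGH FGH'. Qed.

Lemma inter_scale F G H a : inter F G H ->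
  inter F (fun k => a *: G k) (fun k => a *: H k).
Proof. by move=> FGH x; rewrite !lin_scalef linearZ /= FGH. Qed.

Definition at_pos (i : nat) F : op := iter i (@shift R A) F.

End ShiftAlgebra.

Lemma consl_lincomb (R : comNzRingType) (A : choiceType) c (a b : R)
    (x y z : {malg R[seq A]}) :
  consl c (x - a *: y + b *: z) = consl c x - a *: consl c y + b *: consl c z.
Proof. by rewrite linearD linearB !linearZ. Qed.

Definition swap_pos (i j : nat) :=
  if j == i then i.+1 else if j == i.+1 then i else j.

Lemma swap_posl i : swap_pos i i = i.+1.
Proof. by rewrite /swap_pos eqxx. Qed.

Lemma swap_posr i : swap_pos i i.+1 = i.
Proof. by rewrite /swap_pos eqxx gtn_eqF. Qed.

Lemma swap_pos_id i j : j != i -> j != i.+1 -> swap_pos i j = j.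
Proof. by rewrite /swap_pos => /negPf-> /negPf->. Qed.

(** * The R-matrix and multiplication by powers of z_j *)

Section RMatrixOperators.
Variables (R : comNzRingType) (q : int -> R).
Hypothesis qD : forall a b, q (a + b) = q a * q b.
Hypothesis q0 : q 0 = 1.
Local Notation TK := {malg R[seq Idx]}.
Local Notation op := (seq Idx -> TK).
Implicit Types (F G : op) (x y : TK) (i j n : nat) (b : int).

Definition zop b : op := fun k => if k is c :: s then << zsh b c :: s >> else 0.
Definition zat i b : op := at_pos i (zop b).
Definition rmat_at i : op := at_pos i (rmat q).

Lemma zshC b b' c : zsh b (zsh b' c) = zsh b' (zsh b c).
Proof. by rewrite /zsh /= addrAC. Qed.

Lemma zsh_fst b (c : Idx) m (i : 'I_3) :
  (c.1 + b + m, i) = zsh b (c.1 + m, i) :> Idx.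
Proof. by rewrite /zsh /= addrAC. Qed.

Lemma zop_consl b c y : lin (zop b) (consl c y) = consl (zsh b c) y.
Proof. by rewrite /consl lin_lin; apply: eq_lin => k; rewrite linU. Qed.

Lemma inter_zop_shift b F : inter (zop b) (shift F) (shift F).
Proof.
apply: inter_basis => -[|c k] /=; first by rewrite [LHS]lin0 [RHS]lin0.
by rewrite zop_consl linU.
Qed.

Lemma rmat_consl2 c d y : lin (rmat q) (consl c (consl d y)) =
  \sum_(t <- rtab c.2 d.2) let: (n, e, m, i, j) := t in
      (n%:~R * q e) *: consl (d.1 + m, i) (consl (c.1 - m, j) y).
Proof.
rewrite [in LHS]/consl !lin_lin.
transitivity (lin (fun k => rmat q (c :: d :: k)) y).
  by apply: eq_lin => k; rewrite !linU.
rewrite /= lin_sumf; apply: eq_bigr => -[[[[n e] m] i] j] _.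
move: (n%:~R * _) (_, i) (_, j) => a c' d'.
rewrite /consl lin_lin.
transitivity (a *: lin (fun k => << [:: c', d' & k] >> : TK) y).
  exact: lin_scalef.
congr (_ *: _).
by apply: eq_lin => k; rewrite linU.
Qed.

Lemma inter_rmat_shift2 F : inter (rmat q) (shift (shift F)) (shift (shift F)).
Proof.
apply: inter_basis => -[|c [|d k]] /=.
- by rewrite [LHS]lin0 [RHS]lin0.
- by rewrite consl0 [LHS]lin0 [RHS]lin0.
rewrite rmat_consl2 linear_sum; apply: eq_bigr => -[[[[n e] m] i] j] _.
by rewrite linearZ /= linU.
Qed.

Lemma zop_comm b b' : inter (zop b) (zop b') (zop b').
Proof.
apply: inter_basis => -[|c k] /=; first by rewrite [LHS]lin0 [RHS]lin0.
by rewrite [LHS]linU [RHS]linU /= zshC.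
Qed.

Lemma zat_comm i j b b' : inter (zat i b) (zat j b') (zat j b').
Proof.
elim: i j => [|i IH] [|j].
- exact: zop_comm.
- exact: inter_zop_shift.
- exact/inter_sym/inter_zop_shift.
- exact/inter_shift/IH.
Qed.


(** T exchanges two neighbouring z-exponents and then shifts them by amounts that depend on the
    indices alone. *)
Lemma inter_rmat_zat i j b : inter (rmat_at i) (zat j b) (zat (swap_pos i j) b).
Proof.
elim: i j => [|i IH] [|j]; last first.
- rewrite (_ : swap_pos i.+1 j.+1 = (swap_pos i j).+1).
    exact/inter_shift/IH.
  by rewrite /swap_pos eqSS eqSS; case: (j == i); case: (j == i.+1).
- exact/inter_sym/inter_zop_shift.
- case: j => [|j]; last exact: inter_rmat_shift2.
  apply: inter_basis => -[|c [|d k]] /=.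
  + by rewrite [LHS]lin0 [RHS]lin0.
  + by rewrite consl0 [LHS]lin0 [RHS]lin0.
  rewrite /consl [X in lin (rmat q) X]linU [LHS]linU /= linear_sum.
  apply: eq_bigr => -[[[[n e] m] i] j] _.
  by rewrite linearZ /= linU /= zsh_fst.
- apply: inter_basis => -[|c [|d k]] /=.
  + by rewrite [LHS]lin0 [RHS]lin0.
  + by rewrite [LHS]linU [RHS]lin0.
  rewrite linU linear_sum; apply: eq_bigr => -[[[[n e] m] i] j] _.
  by rewrite linearZ /= linU /= /consl linU zsh_fst.
Qed.


Definition zz b i j : op := fun k => lin (zat i b) (zat j (- b) k).

(* Multiplication by (1 - q^2 z_i/z_j) (1 - q^4 z_i/z_j). *)
Definition dop i j : op := fun k =>
  zz 0 i j k - (q 2 + q 4) *: zz 1 i j k + q 6 *: zz 2 i j k.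

Lemma inter_dop F i j i' j' :
  (forall b, inter F (zat i b) (zat i' b)) ->
  (forall b, inter F (zat j b) (zat j' b)) -> inter F (dop i j) (dop i' j').
Proof.
move=> Fi Fj; apply: inter_add; last exact/inter_scale/inter_comp.
by apply: inter_sub; [|apply: inter_scale]; apply: inter_comp.
Qed.

Lemma lin_shift_dop i j x : lin (shift (dop i j)) x = lin (dop i.+1 j.+1) x.
Proof.
apply: eq_lin => k.
have zzS b : zz b i.+1 j.+1 k = shift (zz b i j) k by exact/esym/shift_comp.
rewrite {2}/dop (zzS 0) (zzS 1) (zzS 2).
case: k {zzS} => [|c k] /=; first by rewrite !scaler0 subr0 addr0.
exact: consl_lincomb.
Qed.

Lemma dop_comm i j i' j' : inter (dop i j) (dop i' j') (dop i' j').
Proof.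
by apply: inter_dop => b; apply/inter_sym/inter_dop => b'; apply: zat_comm.
Qed.

Lemma inter_rmat_dop i j k :
  inter (rmat_at i) (dop j k) (dop (swap_pos i j) (swap_pos i k)).
Proof. by apply: inter_dop => b; apply: inter_rmat_zat. Qed.

End RMatrixOperators.

(** * The antisymmetrizer *)

Section Antisymmetrizer.
Variables (R : comNzRingType) (A : choiceType).
Local Notation TA := {malg R[seq A]}.
Local Notation op := (seq A -> TA).
Variables (T : op) (D : nat -> nat -> op).
Local Notation T_ i := (at_pos i T).
Hypothesis T_nil : T [::] = 0.
Hypothesis shiftD : forall i j x, lin (shift (D i j)) x = lin (D i.+1 j.+1) x.
Hypothesis commD : forall i j i' j', inter (D i j) (D i' j') (D i' j').
Hypothesis interTD : forall i j k,
  inter (T_ i) (D j k) (D (swap_pos i j) (swap_pos i k)).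
Hypothesis braidT : forall x,
  lin T (lin (shift T) (lin T x)) = lin (shift T) (lin T (lin (shift T) x)).
Hypothesis interT_shift2 :
  forall F, inter T (shift (shift F)) (shift (shift F)).
Hypothesis interD_shift2 : forall F,
  inter (shift (shift F)) (D 0 1) (D 0 1).
Implicit Types (F G : op) (x y : TA) (i j n : nat).

(** Invariance under the normalised R-matrix T_i / D, written without denominators. *)
Definition fixed i x := lin (T_ i) x = lin (D i i.+1) x.

Lemma fixedZ a i x : fixed i x -> fixed i (a *: x).
Proof. by rewrite /fixed !linearZ /= => ->. Qed.

Lemma fixed_inter F i j x : inter F (T_ i) (T_ j) ->
  inter F (D i i.+1) (D j j.+1) -> fixed i x -> fixed j (lin F x).
Proof. by rewrite /fixed => FT FD fx; rewrite -FT -FD fx. Qed.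

Lemma fixed_consl i c x : fixed i x -> fixed i.+1 (consl c x).
Proof.
by move=> fx; rewrite /fixed -shiftD !lin_shift_consl fx.
Qed.

Lemma fixed_slice i c x : fixed i.+1 x -> fixed i (slice c x).
Proof.
by rewrite /fixed -shiftD -!slice_shift => fx; rewrite -fx.
Qed.

(** The factors D of the pairs formed by the front factor and those behind it; [eprod'] leaves out
    the pair (0, 1), which T treats itself. *)
Fixpoint eprod n : op := fun k =>
  if n is m.+1 then lin (D 0 m.+1) (eprod m k) else << k >>.
Fixpoint eprod' n : op := fun k =>
  if n is m.+1 then lin (D 0 m.+2) (eprod' m k) else << k >>.

Lemma eprod0 x : lin (eprod 0) x = x.
Proof. exact: lin_id. Qed.

Lemma eprod'0 x : lin (eprod' 0) x = x.
Proof. exact: lin_id. Qed.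

Lemma eprodS n x : lin (eprod n.+1) x = lin (D 0 n.+1) (lin (eprod n) x).
Proof. by rewrite lin_lin. Qed.

Lemma eprodS' n x : lin (eprod' n.+1) x = lin (D 0 n.+2) (lin (eprod' n) x).
Proof. by rewrite lin_lin. Qed.

Lemma T_shift_eprod n x :
  lin T (lin (shift (eprod n)) x) = lin (eprod' n) (lin T x).
Proof.
elim: n x => [|n IH] x.
  rewrite eprod'0 lin_lin; apply: eq_lin => -[|c k] /=.
    by rewrite lin0 T_nil.
  by rewrite /consl linU linU.
rewrite eprodS' -IH -lin_shift_comp shiftD.
exact: (interTD 0 1 n.+2).
Qed.

Lemma eprod'_D n x : lin (eprod' n) (lin (D 0 1) x) = lin (eprod n.+1) x.
Proof.
elim: n => [|n IH]; first by rewrite eprod'0 eprodS eprod0.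
by rewrite eprodS' IH -eprodS.
Qed.

Lemma eprod_D n i j : inter (eprod n) (D i j) (D i j).
Proof.
elim: n => [|n IH] x; first by rewrite !eprod0.
by rewrite !eprodS IH commD.
Qed.

Lemma T_eprod_lt i n : (n < i)%N -> inter (T_ i) (eprod n) (eprod n).
Proof.
elim: n => [|n IH] ni x; first by rewrite !eprod0.
rewrite !eprodS interTD IH ?(ltnW ni) //.
rewrite !swap_pos_id ?ltn_eqF // ?ltnS ?(ltnW ni) //.
exact: leq_ltn_trans ni.
Qed.

Lemma T_eprod i n : (i < n)%N -> inter (T_ i.+1) (eprod n.+1) (eprod n.+1).
Proof.
elim: n => // n IH; rewrite ltnS leq_eqVlt => /predU1P[->|lt_in] x.
  rewrite !eprodS !interTD T_eprod_lt // swap_posl swap_posr swap_pos_id //.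
  exact: commD.
rewrite eprodS interTD IH // [RHS]eprodS.
by rewrite !swap_pos_id // gtn_eqF // !ltnS // ltnW.
Qed.

(** The term that moves factor j to the front is (-1)^j T_0 ... T_(j-1) times the D j l for l > j.
    It thus has a T or a D for each pair containing j; the antisymmetrizer of the other factors
    supplies the remaining pairs. *)
Fixpoint xop n : op := fun k => if n is m.+1 then
  eprod m k - lin T (shift (xop m) k) else 0.

Lemma xopS n x :
  lin (xop n.+1) x = lin (eprod n) x - lin T (lin (shift (xop n)) x).
Proof. by rewrite lin_lin -lin_subf. Qed.

(** Positions start at 1, so that slicing off the front factor leaves vectors fixed at some position
    of the others. *)
Inductive fixed_span n : TA -> Prop :=
| Fixed_span0 : fixed_span n 0
| Fixed_spanD i x y : (i.+2 < n)%N -> fixed i.+1 x -> fixed_span n y ->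
    fixed_span n (x + y).

Lemma fixed_span1 n i x : (i.+2 < n)%N -> fixed i.+1 x -> fixed_span n x.
Proof.
by rewrite -{2}[x]addr0 => ltin fx; apply: (Fixed_spanD ltin fx); left.
Qed.

Lemma fixed_span_add n x y :
  fixed_span n x -> fixed_span n y -> fixed_span n (x + y).
Proof.
elim=> [|i x1 x2 ltin fx1 _ IH] sy; first by rewrite add0r.
by rewrite -addrA; apply: (Fixed_spanD ltin fx1 (IH sy)).
Qed.

Lemma fixed_span_sum n (I : Type) (r : seq I) (f : I -> TA) :
  (forall j : I, fixed_span n (f j)) -> fixed_span n (\sum_(i <- r) f i).
Proof.
by move=> sf; apply: big_ind => //; [left | exact: fixed_span_add].
Qed.

(** T_1 T_0 T_1 x = T_0 T_1 T_0 x = T_0 T_1 D x, and D 0 1 becomes D 0 2 when carried past T_1, then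
    D 1 2 past T_0. *)
Lemma braid_fixed x : fixed 0 x ->
  fixed 1 (lin T (lin (shift T) x)).
Proof.
move=> fx; rewrite /fixed -[lin (T_ 1) _]braidT.
rewrite -[lin T x]/(lin (T_ 0) x) fx.
rewrite (interTD 1 0 1) [swap_pos 1 0]/= [swap_pos 1 1]/=.
exact: (interTD 0 0 2).
Qed.

Lemma xop_fixed n i x : (i.+1 < n)%N -> fixed i x ->
  fixed_span n (lin (xop n) x).
Proof.
elim: n i x => // n IH [|i] x lt_in fx.
  case: n lt_in {IH} => // m _.
  (* The coset terms with no T and with one T cancel, since T x = D x; all others start with T_0
     T_1. *)
  have -> : lin (xop m.+2) x =
      lin T (lin (shift T) (lin (shift (shift (xop m))) x)).
    rewrite xopS [xop m.+1]/= lin_shift_subf linearB /= T_shift_eprod.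
    rewrite -[lin T x]/(lin (T_ 0) x) fx eprod'_D opprB addrC subrK.
    by rewrite lin_shift_comp.
  case: m => [|m].
    rewrite [X in lin (shift T) X](_ : _ = 0); last first.
      rewrite -[RHS](lin_zerof _ x); apply: eq_lin => -[|c [|d k]] //=.
      - by rewrite consl0.
      - by rewrite consl0 consl0.
    by rewrite lin0 lin0; left.
  apply: (@fixed_span1 _ 0) => //; apply: braid_fixed.
  apply: fixed_inter fx; first exact/inter_sym/interT_shift2.
  exact: interD_shift2.
(* Away from the front, the product of the D's is symmetric in positions i.+1 and i.+2, and T_0
   commutes with everything at positions 2 and beyond. *)
rewrite xopS; apply: fixed_span_add.
  apply: (@fixed_span1 _ i) => //; apply: fixed_inter fx.
    by apply: inter_sym; case: n lt_in {IH} => // n lt_in; apply: T_eprod.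
  exact: eprod_D.
rewrite lin_shift_slice linear_sum -sumrN; apply: fixed_span_sum => c /=.
have := IH i _ lt_in (fixed_slice c fx).
elim=> [|j x1 x2 ltjn fx1 _ IHx].
  by rewrite consl0 lin0 oppr0; left.
rewrite conslD linD opprD.
apply: (@Fixed_spanD _ j.+1); [exact: ltjn | | exact: IHx].
rewrite -scaleN1r; apply: fixedZ.
apply: (fixed_inter _ _ (fixed_consl c fx1)).
  exact: (interT_shift2 (T_ j)).
exact: (interTD 0 j.+2 j.+3).
Qed.

(* The signed sum over w in S_n of the products of the R-matrices along a
   reduced word of w, with denominators cleared; [xop] is its part that sums
   over the coset representatives bringing one factor to the front. *)
Fixpoint antisym n : op := fun k =>
  if n is m.+1 then lin (shift (antisym m)) (xop m.+1 k) else << k >>.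

Lemma antisymS n x :
  lin (antisym n.+1) x = lin (shift (antisym n)) (lin (xop n.+1) x).
Proof. by rewrite lin_lin. Qed.

Lemma antisym_fixed n i x : (i.+1 < n)%N -> fixed i x ->
  lin (antisym n) x = 0.
Proof.
elim: n i x => // n IH i x lt_in fx; rewrite antisymS.
elim: (xop_fixed lt_in fx) => [|j y z lt_jn fy _ IHz]; first exact: lin0.
rewrite linD IHz addr0 lin_shift_slice big1 // => c _.
by rewrite (IH j) ?consl0 //; apply: fixed_slice.
Qed.

End Antisymmetrizer.

(** * Reduction modulo q *)

Section Reduction.
Variables (S R k : comNzRingType) (iota : {rmorphism S -> R}).
Variable (pi : {rmorphism S -> k}).

(** A relation and not a map: x has a reduction only if its coefficients lie in the image of S. In
    the application S = Q[q], R = Q(q) and pi is evaluation at 0. *)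
Definition reduces_to (B : choiceType) (x : {malg R[B]}) (y : {malg k[B]}) :=
  forall b, exists p, x@_b = iota p /\ y@_b = pi p.

Section Basics.
Variable B : choiceType.
Implicit Types (x : {malg R[B]}) (y : {malg k[B]}).

Lemma reduces0 : reduces_to (0 : {malg R[B]}) 0.
Proof. by move=> b; exists 0; rewrite !mcoeff0 !rmorph0. Qed.

Lemma reducesU b : reduces_to (<< b >> : {malg R[B]}) << b >>.
Proof. by move=> b'; exists (b == b')%:R; rewrite !mcoeffU !rmorph_nat. Qed.

Lemma reducesD x y x' y' :
  reduces_to x y -> reduces_to x' y' -> reduces_to (x + x') (y + y').
Proof.
move=> xy xy' b; have [p [xb yb]] := xy b; have [p' [xb' yb']] := xy' b.
by exists (p + p'); rewrite mcoeffD xb xb' mcoeffD yb yb' !rmorphD.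
Qed.

Lemma reducesZ p x y : reduces_to x y -> reduces_to (iota p *: x) (pi p *: y).
Proof.
move=> xy b; have [p' [xb yb]] := xy b.
by exists (p * p'); rewrite mcoeffZ xb mcoeffZ yb !rmorphM.
Qed.

Lemma reducesB x y x' y' :
  reduces_to x y -> reduces_to x' y' -> reduces_to (x - x') (y - y').
Proof.
move=> xy xy' b; have [p [xb yb]] := xy b; have [p' [xb' yb']] := xy' b.
by exists (p - p'); rewrite mcoeffB xb xb' mcoeffB yb yb' !rmorphB.
Qed.

Lemma reduces_sum (I : Type) (r : seq I) (f : I -> {malg R[B]}) g :
  (forall i, reduces_to (f i) (g i)) ->
  reduces_to (\sum_(i <- r) f i) (\sum_(i <- r) g i).
Proof.
by move=> fg; apply: big_ind2 => //; [exact: reduces0 | exact: reducesD].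
Qed.

End Basics.

Lemma reduces_lin (B B' : choiceType) (F : B -> {malg R[B']}) G x y :
  (forall b, reduces_to (F b) (G b)) -> reduces_to x y ->
  reduces_to (lin F x) (lin G y).
Proof.
move=> FG xy; pose d := (msupp x `|` msupp y)%fset.
rewrite (linEw F (fsubsetUl _ _ : msupp x `<=` d)%fset).
rewrite (linEw G (fsubsetUr _ _ : msupp y `<=` d)%fset).
apply: reduces_sum => b; have [p [-> ->]] := xy b.
exact/reducesZ/FG.
Qed.

Section TensorOps.
Variable A : choiceType.
Implicit Types (F : seq A -> {malg R[seq A]}) (G : seq A -> {malg k[seq A]}).

Definition op_reduces F G := forall b, reduces_to (F b) (G b).

Lemma reduces_comp F F' G G' : op_reduces F G -> op_reduces F' G' ->
  op_reduces (fun b => lin F (F' b)) (fun b => lin G (G' b)).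
Proof. by move=> FG FG' b; apply: reduces_lin. Qed.

Lemma reduces_shift F G : op_reduces F G -> op_reduces (shift F) (shift G).
Proof.
move=> FG [|c b]; first exact: reduces0.
by apply: reduces_lin => // b'; apply: reducesU.
Qed.

Lemma reduces_at_pos i F G : op_reduces F G ->
  op_reduces (at_pos i F) (at_pos i G).
Proof. by move=> FG; elim: i => // i IH; apply: reduces_shift. Qed.

Lemma reduces_antisym T D T' D' n : op_reduces T T' ->
  (forall i j, op_reduces (D i j) (D' i j)) ->
  op_reduces (antisym T D n) (antisym T' D' n).
Proof.
move=> TT DD.
have EE m : op_reduces (eprod D m) (eprod D' m).
  elim: m => [|m IH]; first exact: reducesU.
  exact: reduces_comp.
have XX m : op_reduces (xop T D m) (xop T' D' m).
  elim: m => [|m IH] b; first exact: reduces0.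
  apply: reducesB; first exact: EE.
  exact/reduces_comp/reduces_shift.
elim: n => [|n IH]; first exact: reducesU.
exact/reduces_comp/XX/reduces_shift.
Qed.

End TensorOps.

Variables (q : int -> R) (q' : int -> k).
Hypothesis qq' : forall n : nat, exists p, q n%:Z = iota p /\ q' n%:Z = pi p.

Lemma rtab_nonneg i j : all (fun t => 0 <= t.1.1.1.2) (rtab i j).
Proof. by move: i j; do 2!apply: ord3P. Qed.

Lemma reduces_rmat : op_reduces (rmat q) (rmat q').
Proof.
case=> [|c [|d b]]; try exact: reduces0.
rewrite /rmat big_seq [X in reduces_to _ X]big_seq.
rewrite big_mkcond [X in reduces_to _ X]big_mkcond /=.
apply: reduces_sum => t; case: ifP => [tr|_]; last exact: reduces0.
have:= allP (rtab_nonneg c.2 d.2) _ tr.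
case: t {tr} => [[[[n [e|//]] m] i] j] /= _; have [p [-> ->]] := qq' e.
have := reducesZ (n%:~R * p) (reducesU [:: (d.1 + m, i), (c.1 - m, j) & b]).
by rewrite !rmorphM !rmorph_int.
Qed.

Lemma reduces_zat i b : op_reduces (@zat R i b) (@zat k i b).
Proof.
apply: reduces_at_pos => -[|c s]; first exact: reduces0.
exact: reducesU.
Qed.

Lemma reduces_dop i j : op_reduces (dop q i j) (dop q' i j).
Proof.
have zzr b : op_reduces (@zz R b i j) (@zz k b i j).
  by apply: reduces_comp; apply: reduces_zat.
move=> b; rewrite /dop.
have [p2 [-> ->]] := qq' 2; have [p4 [-> ->]] := qq' 4.
have [p6 [-> ->]] := qq' 6; rewrite -!rmorphD.
by apply: reducesD; [apply: reducesB|]; try apply: reducesZ; apply: zzr.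
Qed.

End Reduction.

(** * The antisymmetrizer at q = 0 *)

Section CrystalLimit.
Variable k : comNzRingType.
Local Notation TK := {malg k[seq Idx]}.
Local Notation op := (seq Idx -> TK).
Implicit Types (F G : op) (x y : TK) (c d : Idx) (s u v : seq Idx).

(** The powers of q at q = 0. Negative exponents get the dummy value 0, so this is not
    multiplicative; [rtab_nonneg] keeps them out of the reduction. *)
Definition q_zero (e : int) : k := (e == 0)%:R.
Local Notation T := (rmat q_zero).
Local Notation D := (dop q_zero).

Definition hmin c d : int := (minn (c.2 : nat) (2 - (d.2 : nat)))%:Z.

(** One term of each row survives: the combinatorial R-matrix of the crystal, whose z-exponent is
    the energy of v_i (x) v_j. *)
Lemma rtab_zero i j : [seq t <- rtab i j | t.1.1.1.2 == 0] =
  [:: (1, 0, (minn (i : nat) (2 - (j : nat)))%:Z, i, j)].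
Proof. by move: i j; do 2!apply: ord3P. Qed.

Lemma rmat_zero c d s :
  T (c :: d :: s) = << (d.1 + hmin c d, c.2) :: (c.1 - hmin c d, d.2) :: s >>.
Proof.
rewrite /rmat (bigID (fun t => t.1.1.1.2 == 0)) /= [X in _ + X]big1 ?addr0.
  rewrite -big_filter rtab_zero big_seq1.
  by rewrite mul1r /q_zero eqxx scale1r.
move=> [[[[n e] m] i] j] /= /negPf e0.
by rewrite /q_zero e0 mulr0 scale0r.
Qed.

Lemma zsh0 c : zsh 0 c = c.
Proof. by case: c => a i; rewrite /zsh addr0. Qed.

Lemma zat_zero i s : (@zat k i 0) s = if (i < size s)%N then << s >> else 0.
Proof.
elim: i s => [|i IH] [|c s]; [by [] | by rewrite /zat [LHS]/= zsh0 | by [] | ].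
rewrite -[LHS]/(consl c (@zat k i 0 s)) IH [size _]/= ltnS.
by case: ifP => _; [rewrite /consl linU | exact: consl0].
Qed.

Lemma dop_zero i j s :
  D i j s = if (maxn i j < size s)%N then << s >> else 0.
Proof.
have [q2 q4 q6] : [/\ q_zero 2 = 0, q_zero 4 = 0 & q_zero 6 = 0] by [].
rewrite /dop q2 q4 q6; move: (@zz k 1 i j s) (@zz k 2 i j s) => x y.
rewrite addr0 !scale0r subr0 addr0 /zz oppr0 zat_zero gtn_max andbC.
by case: (j < size s)%N; [rewrite linU zat_zero | rewrite lin0].
Qed.

Lemma eprod_zero n s : (n < size s)%N -> eprod D n s = << s >>.
Proof.
elim: n => // n IH lt_n; rewrite [LHS]/= IH ?(ltnW lt_n) // linU dop_zero.
by rewrite max0n lt_n.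
Qed.

Definition hhead c s : int := if s is d :: _ then hmin c d else 0.

(* Shifted z-exponents: at q = 0 the R-matrix exchanges two neighbouring
   entries of [pos s] and leaves the indices j in place, and the normally
   ordered s are those for which [pos s] is strictly increasing. *)
Fixpoint pos (s : seq Idx) : seq int :=
  if s is c :: s' then
    c.1 :: [seq m + hhead c s' | m <- pos s']
  else [::].

Definition same_orbit u v :=
  perm_eq (pos u) (pos v) /\ [seq c.2 | c <- u] = [seq c.2 | c <- v].

Lemma same_orbit_refl u : same_orbit u u.
Proof. by []. Qed.

Lemma same_orbit_trans v u w :
  same_orbit u v -> same_orbit v w -> same_orbit u w.
Proof.
by move=> [puv juv] [pvw jvw]; split; [exact: perm_trans pvw | rewrite juv].
Qed.

Lemma same_orbit_cons c u v : same_orbit u v -> same_orbit (c :: u) (c :: v).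
Proof.
move=> [puv juv]; split; last by rewrite [LHS]/= juv.
rewrite [pos _]/= [pos (_ :: v)]/= perm_cons.
have -> : hhead c u = hhead c v.
  by case: u v juv {puv} => [|d u] [|e v] //= [ej _]; rewrite /hmin ej.
exact: perm_map.
Qed.

Definition orbital F := forall u v, v \in msupp (F u) -> same_orbit u v.

Lemma mem_msuppU u v : v \in msupp (<< u >> : TK) -> v = u.
Proof. by move/(fsubsetP msuppU_le); rewrite in_fset1 => /eqP. Qed.

Lemma orbital_id F : (forall u, F u = << u >> \/ F u = 0) -> orbital F.
Proof.
move=> FU u v; case: (FU u) => ->; last by rewrite msupp0 in_fset0.
by move/mem_msuppU->; apply: same_orbit_refl.
Qed.

Lemma orbital_comp F G : orbital F -> orbital G ->
  orbital (fun u => lin F (G u)).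
Proof.
move=> oF oG u v /mem_msupp_lin[w /oG uw /oF wv].
exact: same_orbit_trans wv.
Qed.

Lemma mem_msupp_consl c x v : v \in msupp (consl c x) ->
  exists2 u, u \in msupp x & v = c :: u.
Proof. by case/mem_msupp_lin => u ux /mem_msuppU ->; exists u. Qed.

Lemma orbital_shift F : orbital F -> orbital (shift F).
Proof.
move=> oF [|c u] v /=; first by rewrite msupp0 in_fset0.
by case/mem_msupp_consl => w /oF uw ->; apply: same_orbit_cons.
Qed.

Lemma orbital_rmat : orbital T.
Proof.
move=> [|c [|d u]] v; rewrite ?msupp0 ?in_fset0 // rmat_zero.
move=> /mem_msuppU ->; split=> //.
have hh : hhead (c.1 - hmin c d, d.2) u = hhead d u by case: u.
rewrite /= hh -!map_comp /hmin /= subrK.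
by apply/permP => p /=; rewrite addnCA.
Qed.

Lemma orbital_antisym n : orbital (antisym T D n).
Proof.
have oE m : orbital (eprod D m).
  elim: m => [|m IH]; first by apply: orbital_id => u; left.
  apply: orbital_comp IH; apply: orbital_id => u; rewrite dop_zero.
  by case: ifP; [left | right].
have oX m : orbital (xop T D m).
  elim: m => [|m IH] u v /=; first by rewrite msupp0 in_fset0.
  rewrite -[- _]scaleN1r => /mem_msuppD[/oE//|/mem_msuppZ].
  exact/orbital_comp/orbital_shift/IH/orbital_rmat.
elim: n => [|n IH]; first by apply: orbital_id => u; left.
exact/orbital_comp/oX/orbital_shift.
Qed.

Definition ordered : seq Idx -> bool := sorted (fun c d => 0 < energy c d).

Lemma sorted_pos u : ordered u -> sorted <%R (pos u).
Proof.
elim: u => [|c [|d u] IH] //= /andP[cd /IH /= su]; apply/andP; split.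
  by move: cd; rewrite /energy /hmin; lia.
elim: (map _ (pos u)) (d.1) su => //= m r IHr b /andP[bm /IHr->].
by rewrite ltrD2r bm.
Qed.

Lemma pos_inj u v : pos u = pos v -> [seq c.2 | c <- u] = [seq c.2 | c <- v] ->
  u = v.
Proof.
elim: u v => [|[a i] u IH] [|[b j] v] //= [-> puv] [eij juv].
subst j; congr (_ :: _); apply: IH (juv); move: puv.
have -> : hhead (b, i) u = hhead (b, i) v.
  by case: u v juv => [|d u] [|e v] //= [ej _]; rewrite /hmin ej.
by apply: inj_map; apply: addIr.
Qed.

(** A strictly increasing [pos] is determined by its multiset of values, and [pos] together with the
    indices determines the word. Hence the off-diagonal entries vanish. *)
Lemma ordered_orbit u v : ordered u -> ordered v -> same_orbit u v -> u = v.
Proof.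
move=> /sorted_pos su /sorted_pos sv [puv juv]; apply: pos_inj juv.
exact: (lt_sorted_eq su sv (perm_mem puv)).
Qed.

(* The element moved to the front by the other terms has a larger shifted
   exponent than the minimal one, c.1. *)
Lemma xop_ordered n c u : size u = n -> ordered (c :: u) ->
  exists2 y, xop T D n.+1 (c :: u) = << c :: u >> + y &
    forall v, v \in msupp y -> exists a w, v = (a, c.2) :: w /\ c.1 < a.
Proof.
elim: n c u => [|n IH] c u.
  move/size0nil => -> _; exists 0; last by move=> v; rewrite msupp0 in_fset0.
  by rewrite /= consl0 lin0 subr0 addr0.
case: u => // d u [szu] /andP[cd odu].
have [y yE ysupp] := IH d u szu odu.
exists (- lin T (consl c (xop T D n.+1 (d :: u)))).
  by rewrite [LHS]/= -[lin (D 0 n.+1) _]/(eprod D n.+1 (c :: d :: u))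
    eprod_zero //= szu.
have heads w : w \in msupp (xop T D n.+1 (d :: u)) ->
    exists b w', w = (b, d.2) :: w' /\ d.1 <= b.
  rewrite yE => /mem_msuppD[/mem_msuppU->|/ysupp[b [w' [-> /ltW db]]]].
    by exists d.1, u; rewrite -surjective_pairing.
  by exists b, w'.
move=> v; rewrite msuppN => /mem_msupp_lin[w0 /mem_msupp_consl[w /heads]].
move=> [b [w' [-> db]]] ->; rewrite rmat_zero => /mem_msuppU ->.
exists (b + hmin c (b, d.2)), ((c.1 - hmin c (b, d.2), d.2) :: w'); split=> //.
by move: cd db; rewrite /energy /hmin /=; lia.
Qed.

(** Only the leading term of [xop] begins with c, as all others begin with a larger exponent;
    slicing at c therefore leaves the same entry for u without its first factor. *)
Lemma antisym_ordered_diag n u : size u = n -> ordered u ->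
  (antisym T D n u)@_u = 1.
Proof.
elim: n u => [|n IH] [|c u] // szu ou; first by rewrite mcoeffUU.
case: szu => szu; have [y yE ysupp] := xop_ordered szu ou.
rewrite [antisym _ _ _ _]/= -mcoeff_slice slice_shift.
rewrite -[_ - _]/(xop T D n.+1 (c :: u)) yE linearD /=.
rewrite sliceU.
have -> : slice c y = 0.
  apply/malgP => v; rewrite mcoeff_slice mcoeff0 mcoeff_outdom //.
  apply/negP => /ysupp[a [w [[-> _] /=]]]; rewrite ltxx //.
by rewrite addr0 linU IH //; apply: path_sorted ou.
Qed.

Lemma antisym_ordered n u v : size u = n -> ordered u -> ordered v ->
  (antisym T D n u)@_v = (u == v)%:R.
Proof.
move=> szu ou ov; have [<-|neq] := eqVneq u v.
  exact: antisym_ordered_diag.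
apply: mcoeff_outdom; apply: contra neq => /orbital_antisym uv.
by apply/eqP/ordered_orbit.
Qed.

End CrystalLimit.

Section IndependenceModQ.
Variables (S R k : comNzRingType) (iota : {rmorphism S -> R}).
Variables (pi : {rmorphism S -> k}) (q : int -> R).
Hypothesis iota_inj : injective iota.
Hypothesis q_red :
  forall n : nat, exists p, q n%:Z = iota p /\ q_zero k n%:Z = pi p.

Lemma reduced_ordered_eq0 n (w : {malg R[seq Idx]}) (y : {malg k[seq Idx]}) :
  reduces_to iota pi w y ->
  (forall u, u \in msupp w -> size u = n /\ ordered u) ->
  lin (antisym (rmat q) (dop q) n) w = 0 -> y = 0.
Proof.
move=> wy ow Sw0.
have ker (x : {malg R[seq Idx]}) z b :
    reduces_to iota pi x z -> x@_b = 0 -> z@_b = 0.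
  move=> /(_ b)[p [-> ->]] /eqP; rewrite -(rmorph0 iota).
  by move=> /eqP/iota_inj->; apply: rmorph0.
have yw u : u \in msupp y -> u \in msupp w.
  by rewrite -!mcoeff_neq0; apply: contraNneq => /(ker _ _ _ wy) ->.
pose A' := antisym (rmat (q_zero k)) (dop (q_zero k)) n.
have Sy0 : lin A' y = 0.
  apply/malgP => b; rewrite mcoeff0; apply: (ker 0 (lin A' y) b _ (mcoeff0 b)).
  rewrite -Sw0; apply: reduces_lin wy.
  apply: reduces_antisym; first exact: reduces_rmat q_red.
  by move=> i j; apply: reduces_dop.
apply/malgP => v; rewrite mcoeff0.
case vy: (v \in msupp y); last exact/mcoeff_outdom/negbT.
(* At a normally ordered v the antisymmetrized y has the coefficient that y has. *)
have := congr1 (mcoeff v) Sy0; rewrite mcoeff0 mcoeff_lin => <-.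
rewrite (bigD1_seq v) ?fset_uniq //= big_seq_cond big1 => [|u].
  have [szv ov] := ow v (yw v vy).
  by rewrite addr0 antisym_ordered // eqxx mulr1.
case/andP=> uy neq; have [szu ou] := ow u (yw u uy).
have [szv ov] := ow v (yw v vy).
by rewrite antisym_ordered // (negPf neq) mulr0.
Qed.

End IndependenceModQ.

(** * Operators on two factors given by finite tables *)

(* An entry (n, e, (a, i'), (b, j')) of [t i j] stands for the term
   n q^e z^a v_i' (x) z^b v_j' of the image of v_i (x) v_j. *)
Definition table :=
  'I_3 -> 'I_3 -> seq (int * int * (int * 'I_3) * (int * 'I_3)).

Definition ftab (t : table) : fkey -> fsum := fun k =>
  if k is [:: x; y] then
    [seq (u.1.1.1, u.1.1.2, [:: (x.1.1, x.1.2 + u.1.2.1, u.1.2.2);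
                                (y.1.1, y.1.2 + u.2.1, u.2.2)])
    | u <- t x.2 y.2] else [::].

(** The flag tells e_0 from e_1. The quantum integer [2] = q + q^-1 is split into two entries. *)
Definition e_tab (zero : bool) (j : 'I_3) : seq (int * int * (int * 'I_3)) :=
  match zero, val j with
  | true, 0%N => [:: (1, 0, (1, o1))]
  | true, 1%N => [:: (1, 1, (1, o2)); (1, - 1, (1, o2))]
  | false, 1%N => [:: (1, 1, (0, o0)); (1, - 1, (0, o0))]
  | false, 2%N => [:: (1, 0, (0, o1))]
  | _, _ => [::]
  end.

Definition f_tab (zero : bool) (j : 'I_3) : seq (int * int * (int * 'I_3)) :=
  match zero, val j with
  | false, 0%N => [:: (1, 0, (0, o1))]
  | false, 1%N => [:: (1, 1, (0, o2)); (1, - 1, (0, o2))]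
  | true, 1%N => [:: (1, 1, (- 1, o0)); (1, - 1, (- 1, o0))]
  | true, 2%N => [:: (1, 0, (- 1, o1))]
  | _, _ => [::]
  end.

Definition t_exp (zero : bool) (j : 'I_3) : int :=
  let m := 2 * (1 - (j : nat)%:Z) in if zero then - m else m.

Definition De_tab zero : table := fun i j =>
  [seq (u, (0, j)) | u <- e_tab zero i] ++
  [seq (u.1.1, u.1.2 - t_exp zero i, (0, i), u.2) | u <- e_tab zero j].

Definition Df_tab zero : table := fun i j =>
  [seq (u.1.1, u.1.2 + t_exp zero j, u.2, (0, j)) | u <- f_tab zero i] ++
  [seq (u.1.1, u.1.2, (0, i), u.2) | u <- f_tab zero j].

Definition shift_tab b : table := fun i j => [:: (1, 0, (b, i), (b, j))].
Definition zs_tab (m : int) : table := fun i j =>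
  [:: (1, 0, (m, i), (0, j)); (1, 0, (0, i), (m, j))].
Definition D_tab : table := fun i j =>
  [:: (1, 0, (0, i), (0, j)); (-1, 2, (1, i), (-1, j));
      (-1, 4, (1, i), (-1, j)); (1, 6, (2, i), (-2, j))].

Definition fbasis i j : fkey := [:: (0%N, 0, i); (1%N, 0, j)].

Definition fcommute (F G : fkey -> fsum) : bool :=
  all (fun i => all (fun j =>
    let l : fsum := [:: (1, 0, fbasis i j)] in
    let a := fbind F l in let b := fbind G l in
    [&& fsize 2 a, fsize 2 b & feq (fbind G a) (fbind F b)]) o3s) o3s.

(** The q^h form an infinite family; they are treated in [fixed2_weight] instead. *)
Lemma tables_commute :
  all (fun t => fcommute frmat (ftab t) && fcommute (ftab D_tab) (ftab t))
    [:: De_tab true; De_tab false; Df_tab true; Df_tab false;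
        shift_tab 1; shift_tab (-1); zs_tab 1].
Proof. by vm_compute. Qed.

Section TwoFactors.
Variables (R : comNzRingType) (q : int -> R).
Hypothesis qD : forall a b, q (a + b) = q a * q b.
Hypothesis q0 : q 0 = 1.
Local Notation TR := {malg R[seq Idx]}.
Local Notation op := (seq Idx -> TR).
Implicit Types (F G : op) (x y : TR) (c d : Idx) (s u v : seq Idx).

Definition optab (t : table) : op := fun k =>
  if k is [:: c; d] then
    \sum_(u <- t c.2 d.2) (u.1.1.1%:~R * q u.1.1.2) *:
      << [:: (c.1 + u.1.2.1, u.1.2.2); (d.1 + u.2.1, u.2.2)] >>
  else 0.

Lemma optab_ev t rho k : size k = 2 ->
  optab t (evk rho [::] k) = ev q rho [::] (ftab t k).
Proof.
case: k => [|x [|y []]] //= _; rewrite /ev big_map; apply: eq_bigr => u _.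
by rewrite /evt /evk /= !addrA.
Qed.

Definition two_factors x := forall k, k \in msupp x -> size k = 2.

Definition commute2 F G := forall c d,
  lin F (G [:: c; d]) = lin G (F [:: c; d]).

Lemma commute2_lin F G x : commute2 F G -> two_factors x ->
  lin F (lin G x) = lin G (lin F x).
Proof.
move=> FG x2; rewrite !lin_lin; apply: eq_in_lin => k /x2.
by case: k => [|c [|d []]].
Qed.

Definition formal F (f : fkey -> fsum) := forall rho k, size k = 2 ->
  F (evk rho [::] k) = ev q rho [::] (f k).

Lemma evk_basis c d : [:: c; d] =
  evk (nth 0 [:: c.1; d.1]) [::] (fbasis c.2 d.2).
Proof. by rewrite /evk /= !addr0 -!surjective_pairing. Qed.

Lemma fcommuteP F G f g : formal F f -> formal G g -> fcommute f g ->
  commute2 F G.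
Proof.
move=> Ff Gg /allP fg c d.
move: (fg c.2 (mem_o3s _)) => /allP/(_ d.2 (mem_o3s _)) {fg}.
set l := [:: _]; set rho := nth 0 [:: c.1; d.1].
have Fl l' : fsize 2 l' ->
    lin F (ev q rho [::] l') = ev q rho [::] (fbind f l').
  by apply: ev_fbind_size => // k; apply: Ff.
have Gl l' : fsize 2 l' ->
    lin G (ev q rho [::] l') = ev q rho [::] (fbind g l').
  by apply: ev_fbind_size => // k; apply: Gg.
case/and3P=> sf sg eqfg.
rewrite -[F _]linU -[G _]linU evk_basis -/rho.
have -> : << evk rho [::] (fbasis c.2 d.2) >> = ev q rho [::] l.
  by rewrite /ev big_seq1 /evt /= mul1r q0 scale1r.
rewrite (Gl l isT) (Fl l isT) (Fl _ sg) (Gl _ sf).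
exact/esym/(feq_ev _ _ _ eqfg).
Qed.

End TwoFactors.

(** * Vectors on which T and D agree *)

Section FixedVectors.
Variables (R : comNzRingType) (q : int -> R).
Hypothesis qD : forall a b, q (a + b) = q a * q b.
Hypothesis q0 : q 0 = 1.
Local Notation TR := {malg R[seq Idx]}.
Local Notation op := (seq Idx -> TR).
Implicit Types (F G : op) (x y : TR) (c d : Idx) (s u v : seq Idx).

Definition fixed2 x := two_factors x /\
  lin (rmat q) x = lin (optab q D_tab) x.

Lemma two_factors_lin F x : (forall c d, two_factors (F [:: c; d])) ->
  two_factors x -> two_factors (lin F x).
Proof.
move=> F2 x2 k /mem_msupp_lin[u /x2].
by case: u => [|c [|d []]] // _; apply: F2.
Qed.

Lemma two_factorsU c d : two_factors (<< [:: c; d] >> : TR).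
Proof. by move=> k /mem_msuppU->. Qed.

Lemma two_factorsZ a x : two_factors x -> two_factors (a *: x).
Proof. by move=> x2 k /mem_msuppZ/x2. Qed.

Lemma two_factorsD x y : two_factors x -> two_factors y -> two_factors (x + y).
Proof. by move=> x2 y2 k /mem_msuppD[/x2|/y2]. Qed.

Lemma two_factors_sum (I : Type) (r : seq I) (f : I -> TR) :
  (forall i, two_factors (f i)) -> two_factors (\sum_(i <- r) f i).
Proof.
move=> f2; apply: big_ind => //; last exact: two_factorsD.
by move=> k; rewrite msupp0 in_fset0.
Qed.

Lemma two_factors_optab t c d : two_factors (optab q t [:: c; d]).
Proof.
by apply: two_factors_sum => u; apply/two_factorsZ/two_factorsU.
Qed.

Lemma fixed2_lin F x : (forall c d, two_factors (F [:: c; d])) ->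
  commute2 (rmat q) F -> commute2 (optab q D_tab) F ->
  fixed2 x -> fixed2 (lin F x).
Proof.
move=> F2 TF DF [x2 fx]; split; first exact: two_factors_lin.
by rewrite (commute2_lin TF) // (commute2_lin DF) // fx.
Qed.

Lemma formal_rmat : formal q (rmat q) frmat.
Proof. by move=> rho k; apply: rmat_ev. Qed.

Lemma formal_optab t : formal q (optab q t) (ftab t).
Proof. by move=> rho k; apply: optab_ev. Qed.

Lemma fixed2_optab t x :
  fcommute frmat (ftab t) && fcommute (ftab D_tab) (ftab t) ->
  fixed2 x -> fixed2 (lin (optab q t) x).
Proof.
case/andP=> Tt Dt; apply: fixed2_lin; first exact: two_factors_optab.
- exact: (fcommuteP qD q0 formal_rmat (formal_optab t)).
- exact: (fcommuteP qD q0 (formal_optab _) (formal_optab t)).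
Qed.

Lemma fixed2_lincomb a x y : fixed2 x -> fixed2 y -> fixed2 (a *: x + y).
Proof.
move=> [x2 fx] [y2 fy]; split; first exact/two_factorsD/y2/two_factorsZ.
by rewrite !linearD !linearZ /= fx fy.
Qed.

Lemma fixed2_0 : fixed2 0.
Proof. by split; [move=> k; rewrite msupp0 in_fset0 | rewrite !lin0]. Qed.

Lemma fixed2_vacuum a : fixed2 << [:: (a, o0); (a, o0)] >>.
Proof.
split; first exact: two_factorsU.
rewrite !linU; pose rho (_ : nat) : int := a.
have -> : [:: (a, o0); (a, o0)] =
    evk rho [::] [:: (0%N, 0, o0); (0%N, 0, o0)] by rewrite /evk /rho /= addr0.
by rewrite formal_rmat // formal_optab.
Qed.

Lemma rtab_weight (i j : 'I_3) :
  all (fun t => (t.1.2 : 'I_3) + (t.2 : 'I_3) == i + j)%N (rtab i j).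
Proof. by move: i j; do 2!apply: ord3P. Qed.

Lemma lin_eigen_sum (I : eqType) (r : seq I) (f : I -> TR) F a :
  {in r, forall i, lin F (f i) = a *: f i} ->
  lin F (\sum_(i <- r) f i) = a *: \sum_(i <- r) f i.
Proof.
elim: r => [|i r IH] Ff; first by rewrite !big_nil lin0 scaler0.
rewrite !big_cons linD scalerDr Ff ?mem_head // IH // => j jr.
by apply: Ff; rewrite inE jr orbT.
Qed.

(** T and D preserve the sum of the exponents and the sum of the indices, and q^h acts by a scalar
    depending on these two sums only. *)
Lemma fixed2_weight (chi : int -> nat -> R) x : fixed2 x ->
  fixed2 (lin (fun k : seq Idx => if k is [:: c; d] then
    chi (c.1 + d.1) (c.2 + d.2)%N *: << k >> else 0) x).
Proof.
apply: fixed2_lin => [c d|c d|c d].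
- exact/two_factorsZ/two_factorsU.
- rewrite linearZ /= linU; apply/esym/lin_eigen_sum => t tr.
  have := allP (rtab_weight c.2 d.2) _ tr.
  case: t {tr} => [[[[n e] m] i] j] /= /eqP ij.
  have eqa : d.1 + m + (c.1 - m) = c.1 + d.1.
    by rewrite addrACA subrr addr0 addrC.
  by rewrite linearZ /= linU /= eqa ij !scalerA [X in X *: _ = _]mulrC.
- rewrite linearZ /= linU /optab; apply/esym/lin_eigen_sum => t tr.
  have eqa : c.1 + t.1.2.1 + (d.1 + t.2.1) = c.1 + d.1 /\
      t.1.2.2 = c.2 /\ t.2.2 = d.2.
    move: tr; rewrite !inE => /or4P[] /eqP-> /=; split=> //;
      by rewrite addrACA ?subrr addr0.
  rewrite linearZ /= linU /=; case: eqa => -> [-> ->].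
  by rewrite !scalerA [X in X *: _ = _]mulrC.
Qed.

Lemma zat01 b b' c d s :
  lin (@zat R 0 b) (@zat R 1 b' [:: c, d & s]) =
  << [:: zsh b c, zsh b' d & s] >>.
Proof.
by rewrite -[@zat R 1 b' _]/(consl c << zsh b' d :: s >>) zop_consl /consl linU.
Qed.

Lemma optab_D c d : optab q D_tab [:: c; d] =
  << [:: c; d] >> - (q 2 + q 4) *: << [:: zsh 1 c; zsh (- 1) d] >>
  + q 6 *: << [:: zsh 2 c; zsh (- 2) d] >>.
Proof.
pose e i j : TR := << [:: zsh i c; zsh j d] >>.
have -> : << [:: c; d] >> = e 0 0 by rewrite /e !zsh0.
rewrite -[<< [:: zsh 1 c; _] >>]/(e 1 (- 1)).
rewrite -[<< [:: zsh 2 c; _] >>]/(e 2 (- 2)).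
transitivity (\sum_(u <- D_tab c.2 d.2)
    (u.1.1.1%:~R * q u.1.1.2) *: e u.1.2.1 u.2.1).
  by rewrite /optab; apply: eq_big_seq => u; rewrite !inE => /or4P[] /eqP->.
move: e => e; rewrite /D_tab 4!big_cons big_nil /= q0 mulr1 scale1r.
have m1 : (-1 : int)%:~R = -1 :> R by [].
rewrite addr0 m1 !mulN1r !scaleNr mul1r scalerDl.
by rewrite (opprD (q 2 *: e 1 (- 1))) !addrA.
Qed.

Lemma lin_lincomb F a b x y z :
  lin F (x - a *: y + b *: z) = lin F x - a *: lin F y + b *: lin F z.
Proof. by rewrite linearD linearB !linearZ. Qed.

Lemma catl_lincomb s a b (k0 k1 k2 : seq Idx) :
  catl s (<< k0 >> - a *: << k1 >> + b *: << k2 >> : TR) =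
  << k0 ++ s >> - a *: << k1 ++ s >> + b *: << k2 ++ s >>.
Proof. by rewrite /catl lin_lincomb !linU. Qed.

Lemma zz01 b c d s :
  @zz R b 0 1 [:: c, d & s] = << [:: zsh b c, zsh (- b) d & s] >>.
Proof. exact: zat01. Qed.

Lemma dop01 c d s : dop q 0 1 [:: c, d & s] = catl s (optab q D_tab [:: c; d]).
Proof.
rewrite optab_D catl_lincomb /dop (zz01 0) (zz01 1) (zz01 2).
by rewrite oppr0 zsh0 zsh0.
Qed.

Lemma rmat_catl c d s : rmat q [:: c, d & s] = catl s (rmat q [:: c; d]).
Proof.
rewrite /catl /rmat linear_sum; apply: eq_bigr => -[[[[n e] m] i] j] _.
by rewrite linearZ /= linU.
Qed.

Lemma fixed_catl x s : fixed2 x -> fixed (rmat q) (dop q) 0 (catl s x).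
Proof.
move=> [x2 fx]; rewrite /fixed /catl !lin_lin.
transitivity (catl s (lin (rmat q) x)).
  rewrite /catl lin_lin; apply: eq_in_lin => k /x2.
  by case: k => [|c [|d []]] // _; rewrite linU [LHS]rmat_catl.
rewrite fx /catl lin_lin; apply: eq_in_lin => k /x2.
by case: k => [|c [|d []]] // _; rewrite linU dop01.
Qed.

Lemma antisym_sandwich n p s x : (size p + 2 + size s)%N = n -> fixed2 x ->
  lin (antisym (rmat q) (dop q) n) (lin (fun k => << p ++ k ++ s >>) x) = 0.
Proof.
move=> szn fx; pose y u := lin (fun k => << u ++ k ++ s >> : TR) x.
have fy u : fixed (rmat q) (dop q) (size u) (y u).
  elim: u => [|c u IH]; first exact: fixed_catl.
  have -> : y (c :: u) = consl c (y u).
    by rewrite /consl lin_lin; apply: eq_lin => k; rewrite linU.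
  by apply: fixed_consl IH => i j z; apply: lin_shift_dop.
apply: (antisym_fixed _ _ _ _ _ _ _ _ (fy p));
  last by rewrite -szn addn2 addSn ltnS leq_addr.
- by [].
- by move=> i j z; apply: lin_shift_dop.
- by move=> *; apply: dop_comm.
- by move=> *; apply: inter_rmat_dop.
- exact: rmat_braid.
- by move=> *; apply: inter_rmat_shift2.
- move=> F; apply: inter_dop => b; apply: inter_sym.
  + exact: inter_zop_shift.
  + exact/inter_shift/inter_zop_shift.
Qed.

Lemma big_De_tab (V : nmodType) z i j (f : _ -> V) :
  \sum_(u <- De_tab z i j) f u = \sum_(u <- e_tab z i) f (u, (0, j)) +
    \sum_(u <- e_tab z j) f (u.1.1, u.1.2 - t_exp z i, (0, i), u.2).
Proof. by rewrite big_cat !big_map. Qed.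

Lemma big_Df_tab (V : nmodType) z i j (f : _ -> V) :
  \sum_(u <- Df_tab z i j) f u =
    \sum_(u <- f_tab z i) f (u.1.1, u.1.2 + t_exp z j, u.2, (0, j)) +
    \sum_(u <- f_tab z j) f (u.1.1, u.1.2, (0, i), u.2).
Proof. by rewrite big_cat !big_map. Qed.

Lemma optab_De z a i b j : optab q (De_tab z) [:: (a, i); (b, j)] =
  \sum_(u <- e_tab z i) (u.1.1%:~R * q u.1.2) *:
    << [:: (a + u.2.1, u.2.2); (b, j)] >> +
  \sum_(u <- e_tab z j) (u.1.1%:~R * (q u.1.2 * q (- t_exp z i))) *:
    << [:: (a, i); (b + u.2.1, u.2.2)] >>.
Proof.
apply: etrans (big_De_tab z i j _) (f_equal2 +%R _ _).
  by apply: eq_bigr => u _; rewrite /= (addr0 b).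
by apply: eq_bigr => u _; rewrite /= (addr0 a) qD.
Qed.

Lemma optab_Df z a i b j : optab q (Df_tab z) [:: (a, i); (b, j)] =
  \sum_(u <- f_tab z i) (u.1.1%:~R * (q u.1.2 * q (t_exp z j))) *:
    << [:: (a + u.2.1, u.2.2); (b, j)] >> +
  \sum_(u <- f_tab z j) (u.1.1%:~R * q u.1.2) *:
    << [:: (a, i); (b + u.2.1, u.2.2)] >>.
Proof.
apply: etrans (big_Df_tab z i j _) (f_equal2 +%R _ _).
  by apply: eq_bigr => u _; rewrite /= (addr0 b) qD.
by apply: eq_bigr => u _; rewrite /= (addr0 a).
Qed.

Lemma optab_shift b c d :
  optab q (shift_tab b) [:: c; d] = << [:: zsh b c; zsh b d] >>.
Proof. by rewrite /optab big_seq1 mul1r q0 scale1r. Qed.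

Lemma optab_zs m c d : optab q (zs_tab m) [:: c; d] =
  << [:: zsh m c; d] >> + << [:: c; zsh m d] >>.
Proof.
pose e i j : TR := << [:: zsh i c; zsh j d] >>.
transitivity (e m 0 + e 0 m); last by rewrite /e !zsh0.
transitivity (\sum_(u <- zs_tab m c.2 d.2)
    (u.1.1.1%:~R * q u.1.1.2) *: e u.1.2.1 u.2.1).
  by rewrite /optab; apply: eq_big_seq => u; rewrite !inE => /orP[] /eqP->.
by move: e => e; rewrite /zs_tab big_cons big_seq1 /= q0 mulr1 !scale1r.
Qed.

End FixedVectors.

(** * The subspace N *)

Definition qpow (e : int) : Qq := q ^ e.

Lemma q_neq0 : q != 0.
Proof. by rewrite tofrac_eq0 polyX_eq0. Qed.

Lemma qpowD a b : qpow (a + b) = qpow a * qpow b.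
Proof. by rewrite /qpow expfzDr ?q_neq0. Qed.

Lemma qpow0 : qpow 0 = 1.
Proof. exact: expr0z. Qed.

Lemma q_sub_inv_neq0 : q - q^-1 != 0.
Proof.
apply/eqP => /(congr1 ( *%R^~ q)); rewrite mul0r mulrBl mulVf ?q_neq0 //.
move/eqP; rewrite subr_eq0 -[q * q]tofracM -tofrac1 tofrac_eq => /eqP.
move/(congr1 (fun p : {poly rat} => p`_0)).
by rewrite coefMX coef1 eqxx => /eqP; rewrite eq_sym oner_eq0.
Qed.

Lemma qint1 : qint 1 = 1.
Proof. by rewrite /qint expr1z exprN1 divff ?q_sub_inv_neq0. Qed.

Lemma qint2 : qint 2 = qpow 1 + qpow (- 1).
Proof.
rewrite /qint /qpow expr1z exprN1 -[q ^ (- 2)]exprz_inv.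
rewrite -!exprnP subr_sqr mulrAC divff ?q_sub_inv_neq0 //.
by rewrite mul1r.
Qed.

Lemma vb_ord a (j : 'I_3) : vb a (j : nat)%:Z = << (a, j) >>.
Proof.
rewrite /vb (_ : (_ && _) = true); first by rewrite absz_nat inord_val.
by move: j; apply: ord3P.
Qed.

Lemma vb_lt0 a : vb a (- 1) = 0.
Proof. by []. Qed.

Lemma vb_gt2 a : vb a 3 = 0.
Proof. by []. Qed.

Definition tab_vec (a : int) (r : seq (int * int * (int * 'I_3))) : V1 :=
  \sum_(u <- r) (u.1.1%:~R * qpow u.1.2) *: << (a + u.2.1, u.2.2) >>.

Lemma tab_vec0 a : tab_vec a [::] = 0.
Proof. exact: big_nil. Qed.

Lemma tab_vec1 a m j : tab_vec a [:: (1, 0, (m, j))] = << (a + m, j) >>.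
Proof. by rewrite /tab_vec big_seq1 /= qpow0 mulr1 scale1r. Qed.

Lemma tab_vec2 a m j : tab_vec a [:: (1, 1, (m, j)); (1, - 1, (m, j))] =
  qint 2 *: << (a + m, j) >>.
Proof. by rewrite /tab_vec big_cons big_seq1 /= !mul1r -scalerDl qint2. Qed.

Lemma act_e_tab i a j : act_e i (a, j) = tab_vec a (e_tab (val i == 0%N) j).
Proof.
rewrite /act_e; case: ifP => _; move: j; apply: ord3P => /=.
- by rewrite tab_vec1 add0r qint1 scale1r (vb_ord _ o1).
- by rewrite tab_vec2 (vb_ord _ o2).
- by rewrite tab_vec0 vb_gt2 scaler0.
- by rewrite tab_vec0 sub0r vb_lt0 scaler0.
- by rewrite tab_vec2 (vb_ord _ o0) addr0.
- by rewrite tab_vec1 qint1 scale1r (vb_ord _ o1) addr0.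
Qed.

Lemma act_f_tab i a j : act_f i (a, j) = tab_vec a (f_tab (val i == 0%N) j).
Proof.
rewrite /act_f; case: ifP => _; move: j; apply: ord3P => /=.
- by rewrite tab_vec0 sub0r vb_lt0 scaler0.
- by rewrite tab_vec2 (vb_ord _ o0).
- by rewrite tab_vec1 qint1 scale1r (vb_ord _ o1).
- by rewrite tab_vec1 add0r qint1 scale1r (vb_ord _ o1) addr0.
- by rewrite tab_vec2 (vb_ord _ o2) addr0.
- by rewrite tab_vec0 vb_gt2 scaler0.
Qed.

Lemma act_qh_cor i c : act_qh (hcor i) c =
  qpow (t_exp (val i == 0%N) c.2) *: << c >>.
Proof.
case: c => a j; rewrite /act_qh /qpow /pairing /hcor /t_exp /=.
by case: ifP => _ /=; rewrite !(mul0r, mul1r, addr0, add0r).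
Qed.

Lemma act_qh_neg i c : act_qh (hneg (hcor i)) c =
  qpow (- t_exp (val i == 0%N) c.2) *: << c >>.
Proof.
case: c => a j; rewrite /act_qh /qpow /pairing /hcor /t_exp /=.
by case: ifP => _ /=; rewrite !(mulN1r, oppr0, mul0r, mul1r, addr0, add0r).
Qed.

Lemma tensE x y :
  tens x y = lin (fun c => lin (fun d => << [:: c; d] >> : VT) y) x.
Proof.
rewrite linE; apply: eq_bigr => c _; rewrite linE scaler_sumr.
by apply: eq_bigr => d _; rewrite scalerA.
Qed.

Lemma tens_tab_left a r (z : Qq) d : tens (tab_vec a r) (z *: << d >>) =
  \sum_(u <- r) (u.1.1%:~R * (qpow u.1.2 * z)) *:
    << [:: (a + u.2.1, u.2.2); d] >>.
Proof.
rewrite tensE linear_sum; apply: eq_bigr => u _.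
by rewrite linearZ /= linU linearZ /= linU scalerA mulrA.
Qed.

Lemma tens_tab_right (z : Qq) c b r : tens (z *: << c >>) (tab_vec b r) =
  \sum_(u <- r) (u.1.1%:~R * (qpow u.1.2 * z)) *:
    << [:: c; (b + u.2.1, u.2.2)] >>.
Proof.
rewrite tensE linearZ /= linU linear_sum scaler_sumr; apply: eq_bigr => u _.
rewrite linearZ /= linU scalerA; congr (_ *: _).
by rewrite mulrC mulrA.
Qed.

Lemma tens_tab_left1 a r d : tens (tab_vec a r) << d >> =
  \sum_(u <- r) (u.1.1%:~R * qpow u.1.2) *: << [:: (a + u.2.1, u.2.2); d] >>.
Proof.
rewrite -[X in tens _ X]scale1r tens_tab_left.
by apply: eq_bigr => u _; rewrite mulr1.
Qed.

Lemma tens_tab_right1 c b r : tens << c >> (tab_vec b r) =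
  \sum_(u <- r) (u.1.1%:~R * qpow u.1.2) *: << [:: c; (b + u.2.1, u.2.2)] >>.
Proof.
rewrite -[X in tens X _]scale1r tens_tab_right.
by apply: eq_bigr => u _; rewrite mulr1.
Qed.

Lemma ext2_lin F x : ext2 F x =
  lin (fun k => if k is [:: c; d] then F c d else 0) x.
Proof. by rewrite linE; apply: eq_bigr => -[|c [|d []]]. Qed.

Lemma Delta_e_tab i x :
  Delta_e i x = lin (optab qpow (De_tab (val i == 0%N))) x.
Proof.
rewrite [LHS]ext2_lin; apply: eq_lin => -[|[a j] [|[b l] []]] //.
by rewrite !act_e_tab act_qh_neg tens_tab_left1 tens_tab_right (optab_De qpowD).
Qed.

Lemma Delta_f_tab i x :
  Delta_f i x = lin (optab qpow (Df_tab (val i == 0%N))) x.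
Proof.
rewrite [LHS]ext2_lin; apply: eq_lin => -[|[a j] [|[b l] []]] //.
by rewrite !act_f_tab act_qh_cor tens_tab_left tens_tab_right1 (optab_Df qpowD).
Qed.

Lemma z_z_tab x : z_z x = lin (optab qpow (shift_tab 1)) x.
Proof.
rewrite [LHS]ext2_lin; apply: eq_lin => -[|c [|d []]] //.
exact/esym/(optab_shift qpow0).
Qed.

Lemma zinv_zinv_tab x : zinv_zinv x = lin (optab qpow (shift_tab (-1))) x.
Proof.
rewrite [LHS]ext2_lin; apply: eq_lin => -[|c [|d []]] //.
exact/esym/(optab_shift qpow0).
Qed.

Lemma z1_1z_tab x : z1_1z x = lin (optab qpow (zs_tab 1)) x.
Proof.
rewrite [LHS]ext2_lin; apply: eq_lin => -[|c [|d []]] //.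
exact/esym/(optab_zs qpow0).
Qed.

Lemma Delta_qh_weight h x : Delta_qh h x =
  lin (fun k : seq Idx => if k is [:: c; d] then
    qpow (h.1.1 * - (2 * (2 - (c.2 + d.2)%N%:Z))
          + h.1.2 * (2 * (2 - (c.2 + d.2)%N%:Z)) + h.2 * (c.1 + d.1)) *: << k >>
    else 0) x.
Proof.
rewrite [LHS]ext2_lin; apply: eq_lin => -[|[a i] [|[b j] []]] //.
rewrite /act_qh tensE linearZ /= linU linearZ /= linU scalerA.
rewrite -/(qpow _) -/(qpow _) -qpowD; congr (qpow _ *: _).
rewrite /pairing /= PoszD; set m := (i : nat)%:Z; set m' := (j : nat)%:Z.
ring.
Qed.

Lemma v0E : v0 = (0, o0).
Proof. by congr (_, _); apply: val_inj. Qed.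

Lemma Nsub_fixed2 x : Nsub x -> fixed2 qpow x.
Proof.
elim=> {x} [||a x y _ fx _ fy|i x _ fx|i x _ fx|h x _ fx|x _ fx|x _ fx|x _ fx].
- by rewrite v0E; apply: fixed2_vacuum.
- exact: fixed2_0.
- exact: fixed2_lincomb.
- rewrite Delta_e_tab; case: (val i == 0%N);
    by apply: (fixed2_optab qpowD qpow0) fx; have /and4P[] := tables_commute.
- rewrite Delta_f_tab; case: (val i == 0%N);
    by apply: (fixed2_optab qpowD qpow0) fx; have /and5P[] := tables_commute.
- rewrite Delta_qh_weight; apply: (fixed2_weight (fun m n =>
    qpow (h.1.1 * - (2 * (2 - n%:Z)) + h.1.2 * (2 * (2 - n%:Z)) + h.2 * m))).
  exact: fx.
- rewrite z_z_tab; apply: (fixed2_optab qpowD qpow0) fx.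
  by have /and5P[_ _ _ _ /andP[]] := tables_commute.
- rewrite zinv_zinv_tab; apply: (fixed2_optab qpowD qpow0) fx.
  by have /and5P[_ _ _ _ /and3P[]] := tables_commute.
- rewrite z1_1z_tab; apply: (fixed2_optab qpowD qpow0) fx.
  by have /and5P[_ _ _ _ /and4P[]] := tables_commute.
Qed.

Lemma Nn_antisym n x : Nn n x -> lin (antisym (rmat qpow) (dop qpow) n) x = 0.
Proof.
elim=> [|a y z _ ky _ kz|p s y szn /Nsub_fixed2 fy].
- exact: lin0.
- by rewrite linearP /= ky kz scaler0 addr0.
- have -> : sandwich p y s = lin (fun k => << p ++ k ++ s >>) y by rewrite linE.
  exact: antisym_sandwich qpowD qpow0 _ _ _ _ szn fy.
Qed.

Section FractionQuotient.
Local Open Scope quotient_scope.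

Lemma frac_quotient (R : idomainType) (x : {fraction R}) :
  exists n d : R, d != 0 /\ x * FracField.tofrac d = FracField.tofrac n.
Proof.
elim/quotW: x => x; exists (frac x).1, (frac x).2; split.
  exact: denom_ratioP.
apply/eqP; rewrite -[_ * _]/(FracField.mul _ _) !piE.
by rewrite FracField.equivfE /FracField.mulf !numden_Ratio
  ?mulf_neq0 ?denom_ratioP ?oner_eq0 // !mulr1 mulrC.
Qed.

End FractionQuotient.

Section PrimitiveMultiples.
Variables (k K : fieldType) (iota : {rmorphism {poly k} -> K}).
Hypothesis iota_inj : injective iota.
Hypothesis quotient : forall x : K, exists n d : {poly k},
  d != 0 /\ x * iota d = iota n.

Lemma iota_eq0 p : (iota p == 0) = (p == 0).
Proof. by rewrite -(rmorph0 iota) (inj_eq iota_inj). Qed.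

Lemma X_neq0 : iota 'X != 0.
Proof. by rewrite iota_eq0 polyX_eq0. Qed.

Lemma common_denominator (B : choiceType) (ks : seq B) (f : B -> K) :
  exists2 s, s != 0 & forall b, b \in ks -> exists p : {poly k},
    s * f b = iota p.
Proof.
elim: ks => [|b ks [s s0 IH]]; first by exists 1; rewrite ?oner_eq0.
have [n [d [d0 fk]]] := quotient (s * f b).
exists (iota d * s); first by rewrite mulf_neq0 ?iota_eq0.
move=> b'; rewrite inE => /predU1P[->|/IH[p fk']].
  by exists n; rewrite -mulrA mulrC fk.
by exists (d * p); rewrite -mulrA fk' -rmorphM.
Qed.

Lemma primitive_multiple (B : choiceType) (w : {malg K[B]}) : w != 0 ->
  exists s, exists y,
    reduces_to iota (horner_eval (0 : k)) (s *: w) y /\ y != 0.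
Proof.
move=> w0; have [k0 k0w] : exists b, b \in msupp w.
  apply/fset0Pn; apply: contraNneq w0 => ws0; apply/eqP/malgP => b.
  by rewrite mcoeff0 mcoeff_outdom // ws0 in_fset0.
have [s s0 ws] := common_denominator (msupp w) (fun b => w@_b).
have [p0 wp0] := ws k0 k0w.
have p00 : p0 != 0.
  by rewrite -iota_eq0 -wp0 mulf_neq0 // mcoeff_neq0.
have [n] := ubnP (size p0).
elim: n s p0 s0 ws wp0 p00 => // n IH s p0 s0 ws wp0 p00 lt_n.
have int b : exists p : {poly k}, (s *: w)@_b == iota p.
  rewrite mcoeffZ; case kw: (b \in msupp w).
    by have [p ->] := ws b kw; exists p.
  by exists 0; rewrite mcoeff_outdom ?kw // mulr0 rmorph0.
pose y : {malg k[B]} := lin (fun b =>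
  (xchoose (int b)).[0] *: << b >>) (\sum_(b <- msupp w) << b >>).
have yE b : b \in msupp w -> y@_b = (xchoose (int b)).[0].
  move=> kw; rewrite /y linear_sum raddf_sum (bigD1_seq b) ?fset_uniq //=.
  rewrite linU mcoeffZ mcoeffUU mulr1 big1 ?addr0 // => b' neq.
  by rewrite linU mcoeffZ mcoeffU (negPf neq) mulr0.
have y_out b : b \notin msupp w -> y@_b = 0.
  move=> kw; rewrite /y linear_sum raddf_sum big_seq big1 // => b' b'w.
  rewrite /= linU mcoeffZ mcoeffU; case: eqP => [kk|]; last by rewrite mulr0.
  by rewrite -kk b'w in kw.
have red : reduces_to iota (horner_eval (0 : k))
    (s *: w) y.
  move=> b; case kw: (b \in msupp w).
    exists (xchoose (int b)); split; last exact: yE.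
    exact/eqP/(xchooseP (int b)).
  exists 0; rewrite y_out ?kw // !rmorph0; split=> //.
  by rewrite mcoeffZ mcoeff_outdom ?kw // mulr0.
have [y0|] := eqVneq y 0; last by exists s, y.
have div b p : s * w@_b = iota p -> exists p', p = p' * 'X.
  move=> wp; exists (p %/ 'X).
  have : 'X %| p.
    rewrite -['X]subr0 -polyC0 dvdp_XsubCl /root; apply/eqP.
    have [p' [wp' yp']] := red b; move: wp'; rewrite mcoeffZ wp => /iota_inj->.
    by move: yp'; rewrite y0 mcoeff0 /horner_eval => /esym.
  by move/divpK.
have [p1 p1E] := div _ _ wp0.
have sq b p : s * w@_b = iota (p * 'X) ->
    s / iota 'X * w@_b = iota p.
  by move=> wp; rewrite mulrAC wp rmorphM mulfK ?X_neq0.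
apply: (IH (s / iota 'X) p1).
- by rewrite mulf_neq0 ?invr_eq0 ?X_neq0.
- move=> b kw; have [p wp] := ws b kw; have [p' pE] := div _ _ wp.
  by exists p'; apply: sq; rewrite -pE.
- by apply: sq; rewrite -p1E.
- by apply: contraNneq p00 => p10; rewrite p1E p10 mul0r.
- apply: leq_trans (_ : size p0 <= n)%N => //.
  rewrite p1E size_mulX //; apply: contraNneq p00 => p10.
  by rewrite p1E p10 mul0r.
Qed.

End PrimitiveMultiples.

Lemma tofrac_inj : injective (@FracField.tofrac {poly rat}).
Proof. by move=> p p' /eqP; rewrite tofrac_eq => /eqP. Qed.

Lemma qpow_reduces (n : nat) : exists p : {poly rat},
  qpow n%:Z = FracField.tofrac p /\ q_zero rat n%:Z = horner_eval 0 p.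
Proof.
exists 'X^n; split; first by rewrite tofracXn.
by rewrite /horner_eval hornerXn /q_zero expr0n.
Qed.

Lemma normally_orderedP n c :
  normally_ordered n c <-> size c = n /\ ordered c.
Proof.
split=> -[szc oc]; split=> //.
  by apply/(sortedP v0) => i; rewrite szc; apply: oc.
by rewrite -szc; move/(sortedP v0): oc.
Qed.

Lemma ordered_independent n (w : VT) :
  (forall c, c \in msupp w -> normally_ordered n c) -> Nn n w -> w = 0.
Proof.
move=> ow /Nn_antisym Sw0; apply/eqP/negPn/negP => w0.
have [s [y [red /eqP[]]]] :=
  primitive_multiple tofrac_inj (@frac_quotient {poly rat}) w0.
apply: (reduced_ordered_eq0 tofrac_inj qpow_reduces red (n := n)) => [u|].
  by move/mem_msuppZ/ow/normally_orderedP.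
by rewrite linearZ /= Sw0 scaler0.
Qed.

(** * Relations in N *)

Lemma linNsub a x : Nsub x -> Nsub (a *: x).
Proof. by move=> Nx; rewrite -[_ *: _]addr0; apply: N_lin Nx N_zero. Qed.

Lemma Nsub_vacuum b : Nsub << [:: (b, o0); (b, o0)] >>.
Proof.
elim/int_rect: b => [|n IH|n IH]; first by rewrite -v0E; apply: N_gen.
- have -> : n.+1%:Z = n%:Z + 1 by lia.
  by have := N_zz IH; rewrite z_z_tab linU (optab_shift qpow0).
- have -> : - n.+1%:Z = - n%:Z + -1 by lia.
  by have := N_zinv IH; rewrite zinv_zinv_tab linU (optab_shift qpow0).
Qed.

Section Newton.
Variables (R : comNzRingType) (q : int -> R).
Hypothesis q0 : q 0 = 1.
Local Notation TR := {malg R[seq Idx]}.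

Lemma zshD a b c : zsh a (zsh b c) = zsh (b + a) c.
Proof. by rewrite /zsh /= addrA. Qed.

Lemma zs_recurrence (m : nat) (x : TR) : lin (optab q (zs_tab m.+2)) x =
  lin (optab q (zs_tab 1)) (lin (optab q (zs_tab m.+1)) x)
  - lin (optab q (shift_tab 1)) (lin (optab q (zs_tab m)) x).
Proof.
have out t k : size k != 2 -> optab q t k = 0 by case: k => [|c [|d []]].
rewrite !lin_lin -lin_subf; apply: eq_lin => k.
have [sz|sz] := eqVneq (size k) 2; last first.
  by rewrite !(out _ _ sz) lin0 lin0 subr0.
case: k sz => [|c [|d []]] // _.
pose e i j : TR := << [:: zsh i c; zsh j d] >>.
have zs0 b : optab q (zs_tab b) [:: c; d] = e b 0 + e 0 b.
  by rewrite (optab_zs q0) /e !zsh0.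
have zsE b i j : lin (optab q (zs_tab b)) (e i j) = e (i + b) j + e i (j + b).
  by rewrite /e linU (optab_zs q0) !zshD.
have shE i j : lin (optab q (shift_tab 1)) (e i j) = e (i + 1) (j + 1).
  by rewrite /e linU (optab_shift q0) !zshD.
clearbody e; rewrite !zs0 !linD !zsE !shE.
have -> : m.+1%:Z + 1 = m.+2%:Z by lia.
have -> : m%:Z + 1 = m.+1%:Z by lia.
rewrite add0r; move: (e _ 0) (e m.+1 1) (e 1 m.+1) (e 0 m.+2) => A B C D.
by rewrite [C + D]addrC addrACA addrK.
Qed.

End Newton.

Lemma two_factors_zs0 (x : VT) : two_factors x ->
  lin (optab qpow (zs_tab 0)) x = 2 *: x.
Proof.
move=> x2; rewrite -[in RHS](lin_id x) -lin_scalef; apply: eq_in_lin => k /x2.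
case: k => [|c [|d []]] // _; rewrite (optab_zs qpow0) !zsh0.
by rewrite scaler_nat mulr2n.
Qed.

(* Newton's identity p_{m+2} = (z1 + z2) p_{m+1} - z1 z2 p_m. *)
Lemma Nsub_zs (m : nat) x : Nsub x -> Nsub (lin (optab qpow (zs_tab m)) x).
Proof.
move=> Nx; suff [] : Nsub (lin (optab qpow (zs_tab m)) x) /\
    Nsub (lin (optab qpow (zs_tab m.+1)) x) by [].
elim: m => [|m [IH1 IH2]].
  split; last by have := N_z1 Nx; rewrite z1_1z_tab.
  rewrite two_factors_zs0; first exact: linNsub.
  by have [] := Nsub_fixed2 Nx.
split=> //; rewrite (zs_recurrence qpow0) -scaleN1r addrC; apply: N_lin.
  by have := N_zz IH1; rewrite z_z_tab.
by have := N_z1 IH2; rewrite z1_1z_tab.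
Qed.

(* Evaluation at q = 1 after clearing the negative powers of q. *)
Lemma qpow_comb_neq0 (r : seq (int * int)) : \sum_(t <- r) t.1 != 0 ->
  \sum_(t <- r) t.1%:~R * qpow t.2 != 0.
Proof.
move=> sr; pose M : nat := \sum_(t <- r) `|t.2|%N.
have posM t : t \in r -> 0 <= t.2 + M%:Z.
  move=> tr; have : (`|t.2| <= M)%N by rewrite /M (big_rem t) //= leq_addr.
  by lia.
clearbody M.
pose P : {poly rat} := \sum_(t <- r) t.1%:~R * 'X^(absz (t.2 + M%:Z)).
have PE : (\sum_(t <- r) t.1%:~R * qpow t.2) * qpow M%:Z = FracField.tofrac P.
  rewrite /P [RHS]rmorph_sum mulr_suml; apply: eq_big_seq => t tr.
  rewrite [RHS]rmorphM rmorph_int rmorphXn -mulrA -qpowD; congr (_ * _).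
  by rewrite /qpow -{1}(gez0_abs (posM t tr)).
have : P != 0.
  apply/eqP => P0; have := congr1 (horner^~ 1) P0.
  rewrite horner_sum horner0 => /eqP.
  rewrite (_ : \sum_(t <- r) _ = (\sum_(t <- r) t.1)%:~R).
    by rewrite intr_eq0 (negPf sr).
  rewrite rmorph_sum; apply: eq_bigr => t _.
  have -> : t.1%:~R = (t.1%:~R)%:P :> {poly rat} by rewrite rmorph_int.
  by rewrite hornerM hornerC hornerXn expr1n mulr1.
move=> P0; have : FracField.tofrac P != 0 by rewrite tofrac_eq0.
by rewrite -PE; apply: contraNneq => ->; rewrite mul0r.
Qed.

(* A word in e_0 (true) and f_1 (false), and an exponent b, such that the word
   applied to z^b v_0 (x) z^b v_0 has leading term z^h v_i (x) v_j, where
   h = min(i, 2 - j) makes the energy vanish. *)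
Definition word (i j : 'I_3) : int * seq bool :=
  match val i, val j with
  | 0%N, 1%N => (0, [:: false])
  | 0%N, 2%N => (0, [:: false; false])
  | 1%N, 0%N => (0, [:: true])
  | 1%N, 1%N => (0, [:: false; true])
  | 1%N, 2%N => (0, [:: false; false; false])
  | 2%N, 0%N => (0, [:: true; true])
  | 2%N, 1%N => (-1, [:: true; true; true])
  | 2%N, 2%N => (0, [:: false; false; false; false])
  | _, _ => (0, [::])
  end.

Definition letter (b : bool) := if b then De_tab true else Df_tab false.

Fixpoint fword (w : seq bool) (l : fsum) : fsum :=
  if w is b :: w' then fbind (ftab (letter b)) (fword w' l) else l.
Fixpoint fword_size (w : seq bool) (l : fsum) : bool :=
  fsize 2 (fword w l) && (if w is b :: w' then fword_size w' l else true).

Definition frelation (i j : 'I_3) : fsum :=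
  let: (b, w) := word i j in
  fword w [:: (1, 0, [:: (0%N, b, o0); (0%N, b, o0)])].

Definition flead (i j : 'I_3) : fkey :=
  [:: (0%N, (minn i (2 - j))%:Z, i); (0%N, 0, j)].

(* All other terms z^a' v_i' (x) z^b' v_j' of a relation with leading term
   z^a v_i (x) z^b v_j keep the sum of the two levels, and the level of the
   first factor is at least that of z^b v_j and less than that of z^a v_i. *)
Definition level (a : int) (j : 'I_3) : int := 2 * a - (j : nat)%:Z.

Definition flower (i j : 'I_3) (k : fkey) : bool :=
  if k is [:: (n, a, i'); (n', b, j')] then
    [&& n == 0%N, n' == 0%N,
      level a i' + level b j' == level (minn i (2 - j))%:Z i + level 0 j,
      level 0 j <= level a i' & level a i' < level (minn i (2 - j))%:Z i]
  else false.

Lemma frelation_check : all (fun i => all (fun j =>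
  let: (b, w) := word i j in
  let l := [:: (1, 0, [:: (0%N, b, o0); (0%N, b, o0)])] in
  let r := frelation i j in
  [&& fword_size w l,
    foldr (fun t m => t.1.1 + m) 0 [seq t <- r | t.2 == flead i j] != 0 &
    all (fun t => (t.2 == flead i j) || flower i j t.2) r]) o3s) o3s.
Proof. by vm_compute. Qed.

Lemma Nsub_fword rho w l : Nsub (ev qpow rho [::] l) -> fword_size w l ->
  Nsub (ev qpow rho [::] (fword w l)).
Proof.
move=> Nl; elim: w => //= b w IH /andP[_ szw].
have szl : fsize 2 (fword w l) by case: (w) szw => [|? ?] /andP[].
have -> : ev qpow rho [::] (fbind (ftab (letter b)) (fword w l)) =
    lin (optab qpow (letter b)) (ev qpow rho [::] (fword w l)).
  by apply/esym/(ev_fbind_size qpowD _ szl) => k; apply: formal_optab.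
case: b; first by have := N_e ord0 (IH szw); rewrite Delta_e_tab.
by have := N_f ord_max (IH szw); rewrite Delta_f_tab.
Qed.

Definition lower (c d : Idx) (k : seq Idx) := exists c' d', [/\ k = [:: c'; d'],
  level c'.1 c'.2 + level d'.1 d'.2 = level c.1 c.2 + level d.1 d.2,
  level d.1 d.2 <= level c'.1 c'.2 & level c'.1 c'.2 < level c.1 c.2].

Lemma foldr_coef (s : fsum) :
  foldr (fun t m => t.1.1 + m) 0 s = \sum_(t <- s) t.1.1.
Proof. by elim: s => [|t s IH] /=; rewrite ?big_nil // big_cons IH. Qed.

Lemma leading_relation (b : int) (i j : 'I_3) : exists a : Qq, exists2 y : VT,
  a != 0 /\ Nsub (a *: << [:: (b + (minn i (2 - j))%:Z, i); (b, j)] >> + y) &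
  forall k, k \in msupp y -> lower (b + (minn i (2 - j))%:Z, i) (b, j) k.
Proof.
have /allP/(_ i (mem_o3s _))/allP/(_ j (mem_o3s _)) := frelation_check.
rewrite /frelation; case: (word i j) => b0 w; set l := [:: _].
case/and3P=> szw lead low; pose rho (_ : nat) := b.
have Nl : Nsub (ev qpow rho [::] (fword w l)).
  apply: Nsub_fword szw; rewrite /ev big_seq1 /evt mul1r qpow0 scale1r.
  exact: Nsub_vacuum.
move: (fword w l) Nl lead low => r Nr lead low.
exists (\sum_(t <- r | t.2 == flead i j) t.1.1%:~R * qpow t.1.2).
exists (\sum_(t <- r | t.2 != flead i j) evt qpow rho [::] t); first split.
- rewrite -big_filter.
  rewrite -(big_map (fun t => t.1) predT (fun t => t.1%:~R * qpow t.2)).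
  apply: qpow_comb_neq0; rewrite big_map.
  by rewrite -foldr_coef.
- move: Nr; rewrite /ev (bigID (fun t => t.2 == flead i j)) /=.
  set x := \sum_(t <- r | t.2 == flead i j) evt _ _ _ _; set z := _ *: _.
  suff -> : x = z by [].
  rewrite /x /z scaler_suml; apply: eq_bigr => t /eqP tl.
  by rewrite /evt tl /evk /rho /= addr0.
rewrite -big_filter => k /mem_msupp_sum[t].
rewrite mem_filter => /andP[neq tr] /mem_msuppZ/mem_msuppU ->.
have := allP low t tr; rewrite (negPf neq) /flower /=.
case: (t.2) => [|[[n a] i'] [|[[n' a'] j'] []]] //.
case/and5P=> _ _ /eqP e1 e2 e3; exists (b + a, i'), (b + a', j'); split=> //=;
  by move: e1 e2 e3; rewrite /level; lia.
Qed.

Lemma unordered_relation c d : energy c d <= 0 -> exists2 y : VT,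
  Nsub (<< [:: c; d] >> + y) & forall k, k \in msupp y -> lower c d k.
Proof.
case: c d => a i [b j] Ecd.
have [al [y [al0 Ny] low]] := leading_relation b i j.
suff [y' Ny' low'] : exists2 y' : VT,
    Nsub (al *: << [:: (a, i); (b, j)] >> + y') &
    forall k, k \in msupp y' -> lower (a, i) (b, j) k.
  exists (al^-1 *: y') => [|k /mem_msuppZ/low'//].
  by have := linNsub al^-1 Ny'; rewrite scalerDr scalerA mulVf // scale1r.
set h : int := (minn i (2 - j))%:Z in Ny low.
have [m am] : exists m : nat, a = b + h + m%:Z.
  by exists (absz (a - b - h)%R); move: Ecd; rewrite /energy /h /=; lia.
case: m am => [|m] am; first by exists y; rewrite am addr0.
pose Z := optab qpow (zs_tab m.+1).
exists (al *: << [:: (b + h, i); zsh m.+1 (b, j)] >> + lin Z y).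
  have := Nsub_zs m.+1 Ny; rewrite linD linearZ /= linU (optab_zs qpow0).
  by rewrite {1}/zsh /= -am scalerDr addrA.
move=> k /mem_msuppD[/mem_msuppZ/mem_msuppU ->|].
  by exists (b + h, i), (zsh m.+1 (b, j)); split=> //=;
    move: (am) (ltn_ord i) (ltn_ord j); rewrite /level /h; lia.
case/mem_msupp_lin => k' /low[c' [d' [-> e1 e2 e3]]].
rewrite /Z (optab_zs qpow0) => /mem_msuppD[] /mem_msuppU ->.
  exists (zsh m.+1 c'), d'; split=> //=;
    move: (am) e1 e2 e3; rewrite /level /=; lia.
exists c', (zsh m.+1 d'); split=> //=;
    move: (am) e1 e2 e3; rewrite /level /=; lia.
Qed.

(** * Spanning *)

Definition spanned n (v : VT) := exists w : VT,
  (forall c, c \in msupp w -> normally_ordered n c) /\ Nn n (v - w).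

Lemma spanned_Nn n x v : Nn n x -> spanned n v -> spanned n (x + v).
Proof.
move=> Nx [w [ow Nw]]; exists w; split=> //.
by rewrite -addrA -[x]scale1r; apply: Nn_lin.
Qed.

Lemma spanned0 n : spanned n 0.
Proof.
exists 0; split; first by move=> c; rewrite msupp0 in_fset0.
by rewrite subr0; apply: Nn_zero.
Qed.

Lemma spanned_lincomb n a x y :
  spanned n x -> spanned n y -> spanned n (a *: x + y).
Proof.
move=> [v [ov Nv]] [w [ow Nw]]; exists (a *: v + w); split.
  by move=> c /mem_msuppD[/mem_msuppZ/ov|/ow].
by rewrite opprD addrACA -scalerBr; apply: Nn_lin.
Qed.

Lemma spanned_lin n (F : seq Idx -> VT) (x : VT) :
  (forall k, k \in msupp x -> spanned n (F k)) -> spanned n (lin F x).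
Proof.
move=> sF; rewrite linE big_seq_cond; apply: big_rec => [|k y].
  exact: spanned0.
by rewrite andbT => /sF sk sy; apply: spanned_lincomb.
Qed.

Definition lev (c : Idx) : int := level c.1 c.2.

Fixpoint total (k : seq Idx) : int :=
  if k is c :: k' then lev c + total k' else 0.
(* \sum_r r * lev (c_r), the index r starting from 0. *)
Fixpoint moment (k : seq Idx) : int :=
  if k is c :: k' then moment k' + total k' else 0.

Lemma total_cat p k : total (p ++ k) = total p + total k.
Proof. by elim: p => [|c p IH] /=; rewrite ?add0r // IH addrA. Qed.

Lemma moment_swap p c d c' d' s : lev c' + lev d' = lev c + lev d ->
  lev c' < lev c ->
  moment (p ++ [:: c, d & s]) < moment (p ++ [:: c', d' & s]).
Proof.
move=> e lt; elim: p => [|x p IH] /=; first by lia.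
by rewrite !total_cat /=; lia.
Qed.

Definition bounded (M : nat) (k : seq Idx) := all (fun c => `|lev c| <= M%:Z) k.

Lemma moment_bound M k : bounded M k ->
  moment k <= (size k * size k * M)%N%:Z.
Proof.
have total_bound u : bounded M u -> total u <= (size u * M)%N%:Z.
  elim: u => //= c u IH /andP[cM /IH]; rewrite mulSn PoszD.
  by apply: lerD; apply: le_trans cM; apply: ler_norm.
elim: k => //= c k IH /andP[_ kM].
have := IH kM; have := total_bound k kM; nia.
Qed.

Lemma unordered_split k : ~~ ordered k -> exists p c d s,
  k = p ++ [:: c, d & s] /\ energy c d <= 0.
Proof.
elim: k => [|c [|d k] IH] //=; rewrite negb_and.
case/orP=> [|/IH[p [c' [d' [s [-> E]]]]]].
  by rewrite -leNgt => E; exists [::], c, d, k.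
by exists (c :: p), c', d', s.
Qed.

Lemma spanned_basis n k : size k = n -> spanned n << k >>.
Proof.
move=> szk; have [M kM] : exists M, bounded M k.
  elim: k {n szk} => [|c k [M kM]]; first by exists 0%N.
  exists (`|lev c| + M)%N => /=; apply/andP; split; first by lia.
  by apply: sub_all kM => d; lia.
have [N] := ubnP (absz ((n * n * M)%N%:Z - moment k)%R).
elim: N k szk kM => // N IH k szk kM ltN.
have [ok|] := boolP (ordered k).
  exists << k >>; split; last by rewrite subrr; apply: Nn_zero.
  by move=> c /mem_msuppU->; apply/normally_orderedP.
case/unordered_split=> p [c [d [s [kE /unordered_relation[y Ny low]]]]].
have -> : << k >> = sandwich p (<< [:: c; d] >> + y) s +
    (-1) *: lin (fun u => << p ++ u ++ s >>) y.
  have -> : sandwich p (<< [:: c; d] >> + y) s =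
      lin (fun u => << p ++ u ++ s >>) (<< [:: c; d] >> + y) by rewrite linE.
  by rewrite linD linU -kE scaleN1r addrK.
apply: spanned_Nn.
  by apply: Nn_gen Ny; rewrite -szk kE size_cat /= -addnA.
rewrite -[_ *: _]addr0; apply: spanned_lincomb (spanned0 n).
apply: spanned_lin => u /low[c' [d' [-> e l1 l2]]] /=.
have lt := moment_swap p s e l2.
have bd : bounded M (p ++ [:: c', d' & s]).
  move: kM; rewrite kE /bounded !all_cat /= => /and4P[-> cM dM ->].
  by rewrite /= andbT; move: e l1 l2 cM dM; rewrite -!/(lev _); lia.
have szk' : size (p ++ [:: c', d' & s]) = n by rewrite -szk kE !size_cat.
apply: IH => //; have b1 := moment_bound kM; have b2 := moment_bound bd.
rewrite szk in b1; rewrite szk' in b2; rewrite kE in ltN b1.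
move: ltN b1 b2 lt; move: (moment _) (moment _) (n * n * M)%N => m m' B.
by lia.
Qed.

Theorem mainTheorem4 (n : nat) (Hn : (0 < n)%N) :
  quotient_basis (in_tensor_power n) (Nn n) (normally_ordered n).
Proof.
split; last exact: ordered_independent.
move=> v vn; rewrite -[v]lin_id; apply: spanned_lin => k kv.
exact/spanned_basis/vn.
Qed.
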